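(* For every $\mathbb{R}$-multimatroid $\mathbf{M}$ on $(E,\pi)$ with rank function $\mathbf{rk}$, \[\int_{\Sigma^\pi}(D_{\mathbf{M}})^n=\operatorname{Vol}(\mathrm{IPC}(\mathbf{M})),\qquad D_{\mathbf{M}}=\sum_{S\in\mathcal{R}_\pi^\times}\mathbf{rk}(S)\,x_S\in A^1(\Sigma^\pi)\otimes\mathbb{R}.\]
   Context: Let $n\ge1$ and $E$ a finite set with partition $E=E_1\sqcup\cdots\sqcup E_n$ into nonempty blocks. A subset $S\subseteq E$ is colored if $|S\cap E_i|\le1$ for all $i$; $\mathcal{R}_\pi$ denotes the poset of colored subsets, $\mathcal{R}_\pi^\times=\mathcal{R}_\pi\setminus\{\emptyset\}$, and $\mathcal{R}_\pi^{\max}$ the colored subsets meeting every block. $A^*(\Sigma^\pi)=\mathbb{Z}[x_S:S\in\mathcal{R}_\pi^\times]/(\mathcal{I}+\mathcal{J})$ with $\mathcal{I}$ generated by $x_Sx_{S'}$ for incomparable $S,S'$ and $\mathcal{J}$ by $\sum_{S\ni e}x_S-\sum_{S\ni e'}x_S$ for distinct $e,e'$ in a common block; $\int_{\Sigma^\pi}:A^n(\Sigma^\pi)\otimes\mathbb{R}\to\mathbb{R}$ is the linear map with $\int x_{S_1}\cdots x_{S_n}=1$ for each chain $S_1\subsetneq\cdots\subsetneq S_n$ in $\mathcal{R}_\pi^\times$. An $\mathbb{R}$-multimatroid on $(E,\pi)$ is a function $\mathbf{rk}:\mathcal{R}_\pi\to\mathbb{R}$ with (R1) $\mathbf{rk}(\emptyset)=0$;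 (R2) $\mathbf{rk}(S)\le\mathbf{rk}(T)$ whenever $S\subseteq T$ in $\mathcal{R}_\pi$; (R3) $\mathbf{rk}(S\cup T)+\mathbf{rk}(S\cap T)\le\mathbf{rk}(S)+\mathbf{rk}(T)$ whenever $S,T,S\cup T\in\mathcal{R}_\pi$. Let $N^\pi_\mathbb{R}=\prod_{i=1}^n\mathbb{R}^{E_i}/\mathbb{R}\mathbf{e}_{E_i}$ and write $\overline{\mathbf{e}}_j$ for the image of the basis vector $\mathbf{e}_j$, $j\in E$. For $S\in\mathcal{R}_\pi$, $\overline{\mathbb{R}}^S$ is the span of $\{\overline{\mathbf{e}}_i:i\in S\}$ (these are linearly independent). The independence polytope of the restriction to $S$ is $\mathrm{IP}(\mathbf{M}(S))=\{\sum_{i\in S}x_i\overline{\mathbf{e}}_i: x_i\ge0,\ \sum_{i\in X}x_i\le\mathbf{rk}(X)\ \forall X\subseteq S\}$, and $\mathrm{IPC}(\mathbf{M})=\bigcup_{S\in\mathcal{R}_\pi}\mathrm{IP}(\mathbf{M}(S))$. For $T\in\mathcal{R}_\pi^{\max}$, $\operatorname{Vol}_T$ is the Lebesgue measure on $\overline{\mathbb{R}}^T$ normalized so that the simplex $\operatorname{conv}(\{0\}\cup\{\overline{\mathbf{e}}_i:i\in T\})$ has volume $1$, and $\operatorname{Vol}(\mathrm{IPC}(\mathbf{M}))=\sum_{T\in\mathcal{R}_\pi^{\max}}\operatorname{Vol}_T(\mathrm{IP}(\mathbf{M}(T)))$.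
   Formalization: Every block E_i is assumed to have at least two elements instead of being merely nonempty; for a singleton block the image of its basis vector is 0, so the stated linear independence fails and Vol_T and the degree map are not well defined. *)

(* Defs.v *)
From HB Require Import structures.
From mathcomp Require Import all_boot all_order all_algebra.
From mathcomp Require Import generic_quotient ring_quotient.
From mathcomp Require Import boolp.
From mathcomp Require mpoly.

Set Implicit Arguments.
Unset Strict Implicit.
Unset Printing Implicit Defensive.

Import Order.TTheory GRing.Theory Num.Theory.
Local Open Scope ring_scope.

(* A partition E = E_1 + ... + E_n is given by the map c : E -> 'I_n sending
   an element to the index of its block. *)
Definition block (n : nat) (E : finType) (c : E -> 'I_n) (i : 'I_n) : {set E} :=
  [set e | c e == i].

Definition colored (n : nat) (E : finType) (c : E -> 'I_n) (S : {set E}) : bool :=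
  [forall i, (#|S :&: block c i| <= 1)%N].

Definition max_colored (n : nat) (E : finType) (c : E -> 'I_n) (S : {set E}) : bool :=
  colored c S && [forall i, S :&: block c i != set0].

Definition ncolored (n : nat) (E : finType) (c : E -> 'I_n) : finType :=
  {S : {set E} | colored c S && (S != set0)}.

(* The notations of mpoly are incompatible with those of mathcomp-analysis, so
   they are only in scope inside this module. *)
Module ChowDef.
Import mpoly.

Section Chow.
Variables (K : comNzRingType) (n : nat) (E : finType) (c : E -> 'I_n).

Definition chow_poly := {mpoly K[#|ncolored c|]}.

Definition chow_var (S : ncolored c) : chow_poly := 'X_(enum_rank S).

Definition chow_cst (a : K) : chow_poly := a%:MP.

Definition chow_homog (d : nat) (p : chow_poly) : bool := p \is d.-homog.

Inductive chow_gen : chow_poly -> Prop :=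
| ChowIncomparable (S S' : ncolored c) :
    ~~ (val S \subset val S') -> ~~ (val S' \subset val S) ->
    chow_gen (chow_var S * chow_var S')
| ChowLinear (e e' : E) :
    c e = c e' -> e != e' ->
    chow_gen (\sum_(S : ncolored c | e \in val S) chow_var S -
              \sum_(S : ncolored c | e' \in val S) chow_var S).

Inductive chow_span : chow_poly -> Prop :=
| ChowSpan0 : chow_span 0
| ChowSpanD a g p : chow_gen g -> chow_span p -> chow_span (a * g + p).

Definition chow_ideal : {pred chow_poly} := [pred p | `[< chow_span p >]].

Lemma chow_idealP p : reflect (chow_span p) (p \in chow_ideal).
Proof. exact: asboolP. Qed.

Lemma chow_spanD p q : chow_span p -> chow_span q -> chow_span (p + q).
Proof.
by move=> + Hq; elim=> [|a g r Hg _ IH]; rewrite ?add0r// -addrA; constructor.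
Qed.

Lemma chow_spanM b p : chow_span p -> chow_span (b * p).
Proof.
elim=> [|a g r Hg _ IH]; first by rewrite mulr0; constructor.
by rewrite mulrDr mulrA; constructor.
Qed.

Lemma chow_gen_eval0 p : chow_gen p -> meval (fun=> 0) p = 0.
Proof.
case=> [S S' _ _|e e' _ _]; first by rewrite mevalM !mevalXU mulr0.
have V0 (f : E) : meval (fun=> 0)
    (\sum_(S : ncolored c | f \in val S) chow_var S) = 0.
  by rewrite raddf_sum big1// => S _; exact: mevalXU.
by rewrite mevalB !V0 subr0.
Qed.

Lemma chow_span_eval0 p : chow_span p -> meval (fun=> 0) p = 0.
Proof.
elim=> [|a g r Hg _ IH]; first by rewrite meval0.
by rewrite mevalD mevalM (chow_gen_eval0 Hg) IH mulr0 addr0.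
Qed.

Lemma chow_ideal_closed : idealr_closed chow_ideal.
Proof.
split; first by apply/chow_idealP; constructor.
- apply/chow_idealP => /chow_span_eval0/eqP.
  by rewrite meval1 oner_eq0.
- move=> a p q /chow_idealP Hp /chow_idealP Hq; apply/chow_idealP.
  exact/chow_spanD/Hq/chow_spanM.
Qed.

HB.instance Definition _ := isIdealr.Build chow_poly chow_ideal chow_ideal_closed.

(* The Chow ring with coefficients in K. For K = R this is A tensor R: extension
   of scalars commutes with the quotient presenting A over the integers. *)
Definition chow : comNzRingType := {ideal_quot chow_ideal}.

Definition chow_pi (p : chow_poly) : chow := \pi_({ideal_quot chow_ideal})%qT p.

End Chow.
End ChowDef.
Export ChowDef.

From mathcomp Require Import classical_sets reals ereal.
From mathcomp Require Import measure lebesgue_measure lebesgue_integral.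

Local Open Scope classical_set_scope.

Definition chow_x (K : comNzRingType) (n : nat) (E : finType) (c : E -> 'I_n)
    (S : ncolored c) : chow K c :=
  chow_pi (chow_var K S).

Definition chow_scalar (K : comNzRingType) (n : nat) (E : finType)
    (c : E -> 'I_n) (a : K) : chow K c :=
  chow_pi (chow_cst c a).

Definition chow_graded (K : comNzRingType) (n : nat) (E : finType)
    (c : E -> 'I_n) (d : nat) : set (chow K c) :=
  [set chow_pi p | p in [set p | chow_homog d p]].

Arguments chow_graded K [n E] c d _.

(* A K-linear map on the graded piece of degree n is represented by a function
   on the whole ring, whose values outside of that piece are irrelevant. *)
Definition is_degree_map (K : comNzRingType) (n : nat) (E : finType)
    (c : E -> 'I_n) (f : chow K c -> K) : Prop :=
  (forall (a : K) (u v : chow K c),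
     chow_graded K c n u -> chow_graded K c n v ->
     f (chow_scalar c a * u + v) = a * f u + f v) /\
  (forall S : 'I_n -> ncolored c,
     (forall i j : 'I_n, (i < j)%N -> val (S i) \proper val (S j)) ->
     f (\prod_(i < n) chow_x K (S i)) = 1).

(* Definite description: when every block has at least two elements, all maps
   satisfying is_degree_map agree on the graded piece of degree n. *)
Definition chow_degree (K : comNzRingType) (n : nat) (E : finType)
    (c : E -> 'I_n) : chow K c -> K :=
  xget (fun=> 0) [set f | is_degree_map f].

(* The rank function is only constrained, and only ever used, on colored sets;
   its values elsewhere are irrelevant. *)
Record multimatroid (R : realType) (n : nat) (E : finType) (c : E -> 'I_n) :=
  Multimatroid {
    rk :> {set E} -> R;
    rk_set0 : rk finset.set0 = 0;
    rk_mono : forall S T, colored c S -> colored c T ->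
      S \subset T -> rk S <= rk T;
    rk_submod : forall S T, colored c S -> colored c T -> colored c (S :|: T) ->
      rk (S :|: T) + rk (S :&: T) <= rk S + rk T }.

Definition divisor (R : realType) (n : nat) (E : finType) (c : E -> 'I_n)
    (M : multimatroid R c) : chow R c :=
  \sum_(S : ncolored c) chow_scalar c (M (val S)) * chow_x R S.

(* Vectors constant on each block, i.e. the span of the vectors e_{E_i}. *)
Definition block_constant (R : realType) (n : nat) (E : finType)
    (c : E -> 'I_n) : {pred {ffun E -> R}} :=
  [pred v : {ffun E -> R} | [forall e, forall e', (c e == c e') ==> (v e == v e')]].

Arguments block_constant R [n E] c v.

Lemma block_constant_closed (R : realType) (n : nat) (E : finType)
    (c : E -> 'I_n) : zmod_closed (block_constant R c).
Proof.
split=> [|v w /forallP Hv /forallP Hw].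
  by apply/forallP => e; apply/forallP => e'; rewrite !ffunE eqxx implybT.
apply/forallP => e; apply/forallP => e'; apply/implyP => cee'; rewrite !ffunE.
have /forallP/(_ e')/implyP/(_ cee')/eqP -> := Hv e.
by have /forallP/(_ e')/implyP/(_ cee')/eqP -> := Hw e.
Qed.

HB.instance Definition _ (R : realType) (n : nat) (E : finType)
    (c : E -> 'I_n) :=
  GRing.isZmodClosed.Build {ffun E -> R} (block_constant R c)
    (block_constant_closed R c).

Definition NR (R : realType) (n : nat) (E : finType) (c : E -> 'I_n) :
    zmodType := Quotient.quot (block_constant R c).

(* The image in the quotient of a times the basis vector of index e. *)
Definition ebar (R : realType) (n : nat) (E : finType) (c : E -> 'I_n)
    (a : R) (e : E) : NR R c :=
  \pi_(Quotient.quot (block_constant R c))%qT [ffun e' => a *+ (e' == e)].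

Definition lincomb (R : realType) (n : nat) (E : finType) (c : E -> 'I_n)
    (S : {set E}) (x : E -> R) : NR R c :=
  \sum_(e in S) ebar c (x e) e.

Definition indep_polytope (R : realType) (n : nat) (E : finType)
    (c : E -> 'I_n) (M : multimatroid R c) (S : {set E}) : set (NR R c) :=
  [set lincomb c S x | x in [set x : E -> R |
    (forall e, e \in S -> 0 <= x e) /\
    (forall X : {set E}, X \subset S -> \sum_(e in X) x e <= M X)]].

Definition std_simplex (R : realType) (n : nat) (E : finType)
    (c : E -> 'I_n) (T : {set E}) : set (NR R c) :=
  [set lincomb c T x | x in [set x : E -> R |
    (forall e, e \in T -> 0 <= x e) /\ \sum_(e in T) x e <= 1]].

Arguments std_simplex R [n E] c T _.

Fixpoint lebesgue_tuple (R : realType) (n : nat) :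
    set (n.-tuple (measurableTypeR R)) -> \bar R :=
  match n with
  | 0 => \d_[tuple]
  | m.+1 => pushforward (lebesgue_measure \x lebesgue_tuple (n := m))%E
              (fun p => [tuple of p.1 :: p.2])
  end.

(* For T colored and meeting every block, the elements of T correspond to the
   blocks, so that R^n parametrizes the span of the ebar_e, e in T. *)
Definition coord (R : realType) (n : nat) (E : finType) (c : E -> 'I_n)
    (T : {set E}) (t : n.-tuple (measurableTypeR R)) : NR R c :=
  lincomb c T (fun e => tnth t (c e)).

(* Lebesgue measure on the span of the ebar_e, e in T, normalized by the volume
   of the simplex conv({0} + {ebar_e : e in T}); with blocks of size at least 2
   the map coord c T is injective. *)
Definition Vol_at (R : realType) (n : nat) (E : finType) (c : E -> 'I_n)
    (T : {set E}) (A : set (NR R c)) : \bar R :=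
  ((fine (lebesgue_tuple (coord c T @^-1` std_simplex R c T)))^-1%:E *
   lebesgue_tuple (coord c T @^-1` A))%E.

(* The maximal cells of IPC(M), the union of the polytopes IP(M(S)), are the
   IP(M(T)) for T meeting every block. *)
Definition Vol_IPC (R : realType) (n : nat) (E : finType) (c : E -> 'I_n)
    (M : multimatroid R c) : \bar R :=
  (\sum_(T : {set E} | max_colored c T) Vol_at T (indep_polytope M T))%E.

(* Main.v *)
Require Import Defs.
From HB Require Import structures.
From mathcomp Require Import all_boot all_order all_algebra.
From mathcomp Require Import generic_quotient ring_quotient boolp.
From mathcomp Require Import ring lra.
From mathcomp Require mpoly.

(**
The degree map exists because the fan of chains of colored sets is balanced:
the variables x_S act on its Minkowski weights by commuting operators, and the
degree of a monomial is the value at the zero cone of its action on the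
fundamental weight 1.

It is unique, since the linear relations rewrite every monomial as a
combination of squarefree chain monomials. For a maximal colored set T let
rho_T^* x_Y be the sum of the x_S with S \cap T = Y; then
p |-> \sum_T \int rho_T^* p is again a degree map. Hence \int D_M^n is the sum
over T of the degrees of the divisors of the polymatroids S |-> rk (S \cap T),
and it is enough to treat one polymatroid v on {0, ..., n - 1}.

This is done by slicing with a coordinate k. The points x of the polytope with
x_k = s form the polytope of v_s Y = min (v Y) (v (Y + k) - s), and truncating
the polytope at x_k <= s gives the polymatroid v^s X = min (v X) (v (X - k) + s).
The derivative of D_{v^s} in s is alpha, the sum of the x_X with k \in X and
v X - v (X - k) > s, and alpha * D_{v^s}^(m-1) = h_k * D_{v_s}^(m-1), where h_k
is the class of the coordinate hyperplane. So the degree of D_{v^s}^m, like m!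
times the volume, is obtained by integrating m times the same quantity in
dimension m - 1 over the slices; both vanish at s = 0.
*)

Set Implicit Arguments.
Unset Strict Implicit.
Unset Printing Implicit Defensive.
Import Order.TTheory GRing.Theory Num.Theory.

(** * Chains of sets *)

Lemma sum_indicator (K : pzSemiRingType) (I : finType) (a : I) (A : {set I}) :
  (\sum_(e in A) (e == a)%:R = (a \in A)%:R :> K)%R.
Proof.
have [aA|aA] := boolP (a \in A).
  by rewrite (bigD1 a)//= eqxx big1 ?addr0// => e /andP[_ /negPf ->].
by rewrite big1// => e eA; case: eqP => // ea; rewrite -ea eA in aA.
Qed.

Section Chains.
Variables (E G : finType) (v : G -> {set E}).
Hypothesis v_inj : injective v.

Definition comparable_sets (A B : G) : bool := (v A \subset v B) || (v B \subset v A).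

Definition chain (C : {set G}) : bool :=
  [forall A in C, forall B in C, comparable_sets A B].

Lemma chainP (C : {set G}) :
  reflect {in C &, forall A B, comparable_sets A B} (chain C).
Proof.
apply: (iffP forall_inP) => [h A B AC BC|h A AC].
  by have /forall_inP := h A AC; apply.
by apply/forall_inP => B BC; exact: h.
Qed.

Lemma comparable_setsC A B : comparable_sets A B = comparable_sets B A.
Proof. by rewrite /comparable_sets orbC. Qed.

Lemma comparable_setsxx A : comparable_sets A A.
Proof. by rewrite /comparable_sets subxx. Qed.

Lemma chainW (C C' : {set G}) : C \subset C' -> chain C' -> chain C.
Proof.
by move=> /subsetP sC /chainP h; apply/chainP => A B /sC AC /sC BC; exact: h.
Qed.

Lemma chainU1 (C : {set G}) A :
  chain C -> {in C, forall B, comparable_sets A B} -> chain (A |: C).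
Proof.
move=> /chainP h hA; apply/chainP => X Y /setU1P[->|XC] /setU1P[->|YC].
- exact: comparable_setsxx.
- exact: hA.
- by rewrite comparable_setsC hA.
- exact: h.
Qed.

Lemma chain_sub_card (C : {set G}) A B : chain C -> A \in C -> B \in C ->
  #|v A| <= #|v B| -> v A \subset v B.
Proof.
move=> /chainP h AC BC leAB; have /orP[//|BA] := h _ _ AC BC.
have /eqP -> // : v B == v A by rewrite eqEcard BA.
Qed.

Lemma chain_card_inj (C : {set G}) : chain C -> {in C &, injective (fun A => #|v A|)}.
Proof.
move=> hC A B AC BC eqAB; apply: v_inj; apply/eqP; rewrite eqEsubset.
by rewrite !(chain_sub_card hC) ?eqAB.
Qed.

(** Take [a] in [v Y] outside the largest member of the chain strictly below [v Y], if there is one.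
    A member containing [a] is comparable with [v Y] and cannot lie strictly below it. *)
Lemma chain_element (C : {set G}) Y : chain C -> Y \in C -> v Y != set0 ->
  exists2 a, a \in v Y & {in C, forall R, (a \in v R) = (v Y \subset v R)}.
Proof.
move=> hC YC /set0Pn[y yY].
have [/exists_inP[P0 P0C P0Y]|] := boolP [exists P in C, v P \proper v Y]; last first.
  rewrite negb_exists_in => /forall_inP noP; exists y => // R RC.
  apply/idP/idP => [yR|/subsetP]; last exact.
  have /chainP/(_ R Y RC YC)/orP[RY|//] := hC.
  by have := noP _ RC; rewrite properE RY /= negbK.
pose p := [pred P | (P \in C) && (v P \proper v Y)].
have p0 : p P0 by rewrite /= P0C.
case: (arg_maxnP (fun P => #|v P|) p0) => P /andP[PC PY] maxP.
have [_ [a aY aP]] := properP PY; exists a => // R RC.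
apply/idP/idP => [aR|/subsetP]; last exact.
have /chainP/(_ R Y RC YC)/orP[RY|//] := hC.
apply: contraTT aR => YR; have RpY : v R \proper v Y by rewrite properE RY.
have leRP : #|v R| <= #|v P| by apply: maxP; rewrite /= RC.
by apply: contra aP; apply/subsetP/(chain_sub_card hC).
Qed.

Local Open Scope ring_scope.

(* With Q the successor of Y in the chain, the weight is 1 at an element of Y
   outside of the predecessor of Y, and -1 at an element of Q outside of Y. *)
Lemma dual_weight (C : {set G}) Y : chain C -> Y \in C ->
    {in C, forall R, v R != set0} ->
  exists2 l : E -> int,
    (forall e, l e != 0 -> exists2 Q, Q \in C & e \in v Q) &
    {in C, forall R, \sum_(e in v R) l e = (R == Y)%:R}.
Proof.
move=> hC YC ne.
have [a aY ha] := chain_element hC YC (ne _ YC).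
have [/exists_inP[Q0 Q0C YQ0]|] := boolP [exists Q in C, v Y \proper v Q]; last first.
  rewrite negb_exists_in => /forall_inP noQ; exists (fun e => (e == a)%:R).
    by move=> e; have [->|_] := eqVneq e a; [exists Y|rewrite eqxx].
  move=> R RC; rewrite sum_indicator ha//; congr ((nat_of_bool _)%:R).
  apply/idP/eqP => [YR|->]; last exact: subxx.
  have := noQ _ RC; rewrite properE YR /= negbK => RsY.
  by apply: v_inj; apply/eqP; rewrite eqEsubset RsY.
pose p := [pred P | (P \in C) && (v Y \proper v P)].
have p0 : p Q0 by rewrite /= Q0C.
case: (arg_minnP (fun P => #|v P|) p0) => Q /andP[QC YQ] minQ.
have [b bQ hb] := chain_element hC QC (ne _ QC).
exists (fun e => (e == a)%:R - (e == b)%:R).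
  move=> e; have [->|] := eqVneq e a; first by exists Y.
  by have [-> _ _|] := eqVneq e b; first by exists Q.
move=> R RC; rewrite sumrB !sum_indicator ha// hb//.
have [->|RY] := eqVneq R Y; first by rewrite subxx (negPf (proper_subn YQ)).
suff -> : (v Y \subset v R) = (v Q \subset v R) by rewrite subrr.
apply/idP/idP => [YR|]; last exact/subset_trans/proper_sub.
apply: (chain_sub_card hC) => //; apply: minQ; rewrite /= RC properEneq YR andbT /=.
by apply: contra_neq RY => /v_inj.
Qed.

(** * Reduction of words to chains *)

Section Span.
Variables (V : zmodType) (F : seq G -> V) (C0 : seq G) (N : nat).
Hypothesis F_perm : forall s t, perm_eq s t -> F s = F t.
Hypothesis F_incomparable : forall R Q s, Q \in s ++ C0 ->
  ~~ comparable_sets R Q -> F (R :: s) = 0.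
Hypothesis F_set0 : forall R s, v R = set0 -> F (R :: s) = 0.
Hypothesis F_star : forall a Q s, Q \in s ++ C0 -> a \in v Q ->
  \sum_(R | a \in v R) F (R :: s) = 0.
Hypothesis C0_neq0 : {in C0, forall Q, v Q != set0}.
Hypothesis C0_uniq : uniq C0.
Hypothesis C0_chain : chain [set Q in C0].
Hypothesis F_chain : forall C, uniq (C ++ C0) -> chain [set Q in C ++ C0] ->
  size C = N -> F C = 0.

(** Think of [F s] as a linear form evaluated on the monomial of the word [s], times a fixed chain
    monomial [C0]. The relations remove repeated letters one at a time, so a form that vanishes on
    squarefree chain monomials vanishes on all words of the same length. *)
Lemma chain_span s : size s = N -> F s = 0.
Proof.
(* [C] collects the distinct letters already treated, [s] the letters still to be read. *)
suff H C : uniq (C ++ C0) -> chain [set Q in C ++ C0] ->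
    {in C, forall Q, v Q != set0} -> (size s + size C)%N = N -> F (s ++ C) = 0.
  by move=> sN; rewrite -(cats0 s); apply: H => //; rewrite addn0.
elim: s C => [|Y s IH] C uC hC neC sz; first exact: F_chain.
have new R : R \notin C ++ C0 -> F (R :: s ++ C) = 0.
  move=> RC; have [v0|vR] := eqVneq (v R) set0; first exact: F_set0.
  have [/allP cR|/allPn[Q QC RQ]] := boolP (all (comparable_sets R) (C ++ C0)).
    rewrite (@F_perm _ (s ++ R :: C)).
      apply: IH => /=; first by rewrite RC.
      - have -> : [set Q in R :: C ++ C0] = R |: [set Q in C ++ C0].
          by apply/setP => Q; rewrite !inE.
        by apply: chainU1 => // B; rewrite inE => /cR.
      - by move=> Q; rewrite inE => /predU1P[->//|/neC].
      - by rewrite /= addnS -sz.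
    by rewrite perm_sym perm_catC /= perm_cons perm_catC.
  apply: (F_incomparable (Q := Q)) => //.
  by move: QC; rewrite !mem_cat => /orP[->|->]; rewrite ?orbT.
rewrite cat_cons; have [YC|/new//] := boolP (Y \in C ++ C0).
have YC' : Y \in [set Q in C ++ C0] by rewrite inE.
have [R|l lC lY] := dual_weight hC YC'.
  by rewrite inE mem_cat => /orP[/neC|/C0_neq0].
(* A repeated letter [Y] is eliminated with its dual weight: in this combination of star relations
   [Y] is the only letter of the chain with a nonzero coefficient, and all other terms have a new
   first letter. *)
have : \sum_R F (R :: s ++ C) *~ (\sum_(e in v R) l e) = 0.
  under eq_bigr do rewrite mulrz_sumr big_mkcond /=.
  rewrite exchange_big /= big1// => e _.
  rewrite -big_mkcond -mulrz_suml /=.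
  have [->|/lC[Q QC eQ]] := eqVneq (l e) 0; first by rewrite mulr0z.
  rewrite (F_star (Q := Q)) ?mul0rz//.
  by move: QC; rewrite inE !mem_cat => /orP[->|->]; rewrite ?orbT.
rewrite (bigD1 Y)//= lY// eqxx mulr1z big1 ?addr0// => R RY.
have [RC|/new ->] := boolP (R \in C ++ C0); last by rewrite mul0rz.
by rewrite lY ?inE// (negPf RY) mulr0z.
Qed.

End Span.
End Chains.

(** * Colored sets *)

Section Colored.
Variables (n : nat) (E : finType) (c : E -> 'I_n).

Lemma coloredP (S : {set E}) : reflect {in S &, injective c} (colored c S).
Proof.
apply: (iffP forallP) => [h a b aS bS cab|h i].
  apply: (card_le1_eqP (h (c a))); rewrite !inE ?aS ?bS ?cab eqxx//.
apply/card_le1_eqP => a b; rewrite !inE => /andP[aS /eqP ca] /andP[bS /eqP cb].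
by apply: h; rewrite ?ca ?cb.
Qed.

Lemma coloredW (S T : {set E}) : S \subset T -> colored c T -> colored c S.
Proof. by move=> /subsetP ST /coloredP h; apply/coloredP; exact: sub_in2 h. Qed.

Lemma colored_card (S : {set E}) : colored c S -> #|S| <= n.
Proof. by move=> /coloredP h; rewrite -(card_in_imset h) -[leqRHS]card_ord max_card. Qed.

Lemma ncolored_colored (S : ncolored c) : colored c (val S).
Proof. by have /andP[] := valP S. Qed.

Lemma ncolored_neq0 (S : ncolored c) : val S != set0.
Proof. by have /andP[] := valP S. Qed.

Lemma ncolored_inj : injective (val : ncolored c -> {set E}).
Proof. exact: val_inj. Qed.

Lemma block_other (e : E) : (1 < #|block c (c e)|)%N ->
  exists e', (c e' == c e) && (e' != e).
Proof.
rewrite (cardsD1 e) !inE eqxx ltnS card_gt0 => /set0Pn[e'].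
by rewrite !inE => /andP[ne ce]; exists e'; rewrite ce.
Qed.

End Colored.

(** * Minkowski weights *)

Section Weights.
Local Open Scope ring_scope.
Variables (K : comNzRingType) (n : nat) (E : finType) (c : E -> 'I_n).
Hypothesis block_gt1 : forall i, (1 < #|block c i|)%N.

Local Notation G := (ncolored c).
Local Notation v := (val : G -> {set E}).
Local Notation chain := (chain v).

Definition balanced (l : E -> K) : Prop :=
  forall i, \sum_(e in block c i) l e = 0.

Definition pairing (l : E -> K) (R : G) : K := \sum_(e in v R) l e.

(** The weight of [dual_weight] is balanced by subtracting its image under a map [star] that moves
    each element inside its block. The correction is invisible on the chain: if [e'] is in the
    support and [star e'] lies in a member, the larger of two comparable members contains both,
    against coloredness. *)
Lemma dual_balanced_weight (t : {set G}) (S : G) : chain t -> S \in t ->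
  exists2 l, balanced l & {in t, forall R, pairing l R = (R == S)%:R}.
Proof.
move=> ht St.
have [|l0 l0t l0S] := dual_weight (@ncolored_inj _ _ c) ht St.
  by move=> R _; exact: ncolored_neq0.
have other (e : E) := block_other (block_gt1 (c e)).
pose star e := xchoose (other e).
have c_star e : c (star e) = c e by have /andP[/eqP] := xchooseP (other e).
have star_neq e : star e != e by have /andP[] := xchooseP (other e).
pose l e : K := (l0 e)%:~R - \sum_(e' | star e' == e) (l0 e')%:~R.
exists l => [i|R Rt].
  rewrite sumrB; apply/eqP; rewrite subr_eq0; apply/eqP.
  rewrite (exchange_big_dep (fun e => e \in block c i)) /=; last first.
    by move=> e e' ei /eqP se; move: ei; rewrite -se !inE c_star.
  apply: eq_bigr => e; rewrite inE => /eqP cei.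
  rewrite (big_pred1 (star e))// => e' /=; rewrite !inE [star e == e']eq_sym.
  by have [->|] := eqVneq e' (star e); rewrite ?c_star ?cei ?eqxx ?andbF.
rewrite /pairing sumrB [X in _ - X]big1 ?subr0.
  by rewrite -(rmorph_sum intr) l0S//= rmorph_nat.
move=> e eR; rewrite big1// => e' /eqP se.
have [->//|/l0t[Q Qt e'Q]] := eqVneq (l0 e') 0.
have [W eW e'W] : exists2 W : G, e \in v W & e' \in v W.
  have /chainP/(_ R Q Rt Qt)/orP[/subsetP RQ|/subsetP QR] := ht.
    by exists Q => //; exact: RQ.
  by exists R => //; exact: QR.
have /coloredP/(_ e e' eW e'W) ee' := ncolored_colored W.
by have := star_neq e'; rewrite se ee' ?eqxx// -se c_star.
Qed.

Section Action.
Variable lam : {set G} -> G -> E -> K.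
Hypothesis lam_balanced : forall t S, chain t -> S \in t -> balanced (lam t S).
Hypothesis lam_dual : forall t S, chain t -> S \in t ->
  {in t, forall R, pairing (lam t S) R = (R == S)%:R}.

(* The action of x_S on Minkowski weights: it is determined by its value
   w (S |: t) at the cones t not containing S and by the linear relations. *)
Definition cap (S : G) (w : {ffun {set G} -> K}) : {ffun {set G} -> K} :=
  [ffun t : {set G} => if S \in t
    then - \sum_(R | R \notin t) w (R |: t) * pairing (lam t S) R
    else w (S |: t)].

(** Weights of all dimensions are treated at once. The balanced [l] are the linear functions on the
    fan, and balancing at [t] is tested against those that vanish on the rays of [t]. *)
Definition minkowski (w : {ffun {set G} -> K}) : Prop :=
  (forall t, ~~ chain t -> w t = 0) /\
  (forall (t : {set G}) l, balanced l -> {in t, forall R, pairing l R = 0} ->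
    \sum_(R | R \notin t) w (R |: t) * pairing l R = 0).

Lemma cap_notin S w (t : {set G}) : S \notin t -> cap S w t = w (S |: t).
Proof. by rewrite ffunE => /negPf ->. Qed.

Lemma cap_in S w (t : {set G}) : S \in t ->
  cap S w t = - \sum_(R | R \notin t) w (R |: t) * pairing (lam t S) R.
Proof. by rewrite ffunE => ->. Qed.

Lemma cap_not_chain S w t : minkowski w -> ~~ chain t -> cap S w t = 0.
Proof.
move=> [w0 _] ht; have U1 R : w (R |: t) = 0.
  by apply: w0; apply: contra ht; apply: chainW; rewrite subsetUr.
by rewrite ffunE; case: ifP => _ //; rewrite big1 ?oppr0// => R _; rewrite U1 mul0r.
Qed.

Lemma pairingB l1 l2 R : pairing (fun e => l1 e - l2 e) R = pairing l1 R - pairing l2 R.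
Proof. exact: sumrB. Qed.

(** Subtracting from [l] the combination of the [lam t S] with the same values on the rays of [t]
    gives a function to which the balancing of [w] applies. The subtracted part is what [cap]
    contributes at the rays of [t]. *)
Lemma cap_linear w t l : minkowski w -> balanced l ->
  \sum_R cap R w t * pairing l R = 0.
Proof.
move=> mw bl.
have [ht|ht] := boolP (chain t); last first.
  by rewrite big1// => R _; rewrite cap_not_chain// mul0r.
pose l' e := l e - \sum_(S in t) pairing l S * lam t S e.
have l'E R : pairing l' R = pairing l R - \sum_(S in t) pairing l S * pairing (lam t S) R.
  rewrite pairingB; congr (_ - _); rewrite /pairing exchange_big /=.
  by apply: eq_bigr => S _; rewrite mulr_sumr.
have bl' : balanced l'.
  move=> i; rewrite sumrB bl exchange_big /= big1 ?subr0// => S St.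
  by rewrite -mulr_sumr lam_balanced ?mulr0.
have l't : {in t, forall R, pairing l' R = 0}.
  move=> R Rt; rewrite l'E (bigD1 R)//= lam_dual// eqxx mulr1 big1 ?addr0 ?subrr//.
  by move=> S /andP[St SR]; rewrite lam_dual// eq_sym (negPf SR) mulr0.
have := mw.2 t l' bl' l't.
under eq_bigr do rewrite l'E mulrBr.
rewrite sumrB => /eqP; rewrite subr_eq0 => /eqP eqw.
rewrite (bigID (fun R => R \in t)) /=.
under [X in _ + X]eq_bigr => R Rt do rewrite cap_notin//.
rewrite eqw; under eq_bigr => R Rt do rewrite cap_in// mulNr.
rewrite sumrN; under [X in _ + X]eq_bigr do rewrite mulr_sumr.
rewrite [X in _ + X]exchange_big /=.
apply/eqP; rewrite addrC subr_eq0; apply/eqP; apply: eq_bigr => S St.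
by rewrite mulr_suml; apply: eq_bigr => R _; rewrite [pairing l S * _]mulrC mulrA.
Qed.

Lemma cap_swap w (t : {set G}) Q R : Q \notin t -> R \notin t -> cap Q w (R |: t) = cap R w (Q |: t).
Proof.
move=> Qt Rt; have [->//|QR] := eqVneq Q R.
have Q' : Q \notin R |: t by rewrite in_setU1 negb_or QR.
have R' : R \notin Q |: t by rewrite in_setU1 negb_or eq_sym QR.
by rewrite (cap_notin _ Q') (cap_notin _ R') setUCA.
Qed.

(** The weight [lam t S] is dual to [S] on [t], so its linear relation at the cone [R |: t] has,
    among the rays of [t], only the term of [S]. Solving for this term leaves rays [Q] outside [t],
    which [cap_swap] can exchange with [R]. *)
Lemma cap_expand w t R S : minkowski w -> chain t -> S \in t ->
  cap S w (R |: t) = - \sum_(Q | Q \notin t) cap Q w (R |: t) * pairing (lam t S) Q.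
Proof.
move=> mw ht St; apply/eqP; rewrite -addr_eq0; apply/eqP.
rewrite -[RHS](cap_linear (R |: t) mw (lam_balanced ht St)).
rewrite [RHS](bigID (fun R => R \in t)) /= [X in _ = X + _](bigD1 S)//= lam_dual// eqxx mulr1.
rewrite [X in _ = _ + X + _]big1 ?addr0// => Q /andP[Qt QS].
by rewrite lam_dual// (negPf QS) mulr0.
Qed.

Lemma cap_balanced_notin w (t : {set G}) l S : minkowski w -> S \notin t -> balanced l ->
    {in t, forall R, pairing l R = 0} ->
  \sum_(R | R \notin t) cap S w (R |: t) * pairing l R = 0.
Proof.
move=> mw St bl lt0; rewrite -[RHS](cap_linear (S |: t) mw bl).
rewrite [RHS](bigID (fun R => R \in t)) /= [X in _ = X + _]big1 ?add0r.
  by apply: eq_bigr => R Rt; rewrite cap_swap.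
by move=> R Rt; rewrite lt0 ?mulr0.
Qed.

(** For [S] in [t], expanding each term and exchanging the sums leaves, for each ray [Q] outside
    [t], the balancing sum of [cap Q w] at [t]; this vanishes by the linear relation at [Q |: t]. *)
Lemma minkowski_cap w S : minkowski w -> minkowski (cap S w).
Proof.
move=> mw; split=> [t|t l bl lt0]; first exact: cap_not_chain.
have [St|St] := boolP (S \in t); last exact: cap_balanced_notin.
have [ht|ht] := boolP (chain t); last first.
  rewrite big1// => R Rt; rewrite cap_not_chain ?mul0r//.
  by apply: contra ht; apply: chainW; rewrite subsetUr.
under eq_bigr do rewrite cap_expand// mulNr mulr_suml.
rewrite sumrN exchange_big /= big1 ?oppr0// => Q Qt.
under eq_bigr do rewrite mulrAC.
by rewrite -mulr_suml cap_balanced_notin ?mul0r.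
Qed.

(** If at most one of the two rays lies in [t], [cap_swap] suffices, after an expansion when one
    does. If both lie in [t], each side expands to the same double sum over pairs of rays outside
    [t], up to a swap. *)
Lemma capC w S S' : minkowski w -> cap S (cap S' w) = cap S' (cap S w).
Proof.
move=> mw; apply/ffunP => t.
have [ht|ht] := boolP (chain t); last first.
  by rewrite !cap_not_chain//; exact: minkowski_cap.
wlog SS' : S S' / (S' \in t) ==> (S \in t).
  move=> H; have [|] := boolP ((S' \in t) ==> (S \in t)); first exact: H.
  by rewrite negb_imply => /andP[S't St]; apply/esym/H; rewrite S't implybT.
have [St|St] := boolP (S \in t); last first.
  have S't : S' \notin t by move: SS'; rewrite (negPf St) implybF.
  by rewrite (cap_notin _ St) (cap_notin _ S't) cap_swap.
have [S't|S't] := boolP (S' \in t); last first.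
  rewrite (cap_notin _ S't) (cap_in _ St) (cap_expand S' mw ht St); congr (- _).
  by apply: eq_bigr => R Rt; rewrite cap_swap.
rewrite (cap_in _ St) (cap_in _ S't); congr (- _).
under eq_bigr do rewrite cap_expand// mulNr mulr_suml.
under [RHS]eq_bigr do rewrite cap_expand// mulNr mulr_suml.
rewrite !sumrN [X in - X = _]exchange_big /=; congr (- _).
apply: eq_bigr => Q Qt; apply: eq_bigr => R Rt.
by rewrite cap_swap// mulrAC.
Qed.

Lemma cap_incomparable w S S' : minkowski w -> ~~ comparable_sets v S S' ->
  cap S (cap S' w) = 0.
Proof.
move=> mw SS'; apply/ffunP => t; rewrite [RHS]ffunE.
have H (u : {set G}) : S \in u -> cap S' w u = 0.
  move=> Su; have [S'u|S'u] := boolP (S' \in u).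
    rewrite cap_not_chain//; apply/chainP => /(_ S S' Su S'u); exact/negP.
  rewrite cap_notin// mw.1//; apply/chainP => /(_ S S').
  by rewrite !in_setU1 Su eqxx orbT => /(_ isT isT); exact/negP.
have [St|St] := boolP (S \in t); last by rewrite cap_notin// H ?setU11.
by rewrite cap_in// big1 ?oppr0// => R Rt; rewrite H ?mul0r// in_setU1 St orbT.
Qed.

End Action.
End Weights.

(** * Balancing of the fundamental weight *)

Section FundamentalWeight.
Local Open Scope ring_scope.
Variables (K : comNzRingType) (n : nat) (E : finType) (c : E -> 'I_n).

Local Notation G := (ncolored c).
Local Notation v := (val : G -> {set E}).
Local Notation chain := (chain v).

Definition fundamental_weight : {ffun {set G} -> K} :=
  [ffun t => (chain t && (#|t| == n))%:R].

(** The cardinalities in a chain are distinct and lie between 1 and [n], so [n - 1] members leave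
    out exactly one. Ordinals start at 0, hence the shift to [j.+1]. *)
Lemma missing_card (t : {set G}) : chain t -> #|t|.+1 = n ->
  exists2 j : 'I_n, {in t, forall R, #|v R| != j.+1} &
    forall k, (0 < k <= n)%N -> k != j.+1 -> exists2 R, R \in t & #|v R| = k.
Proof.
move=> ht tn; have n0 : (0 < n)%N by rewrite -tn.
have v_gt0 R : (0 < #|v R|)%N by rewrite card_gt0 ncolored_neq0.
have lt_n R : (#|v R|.-1 < n)%N by rewrite prednK// (colored_card (ncolored_colored R)).
pose f R := Ordinal (lt_n R).
have f_inj : {in t &, injective f}.
  move=> A B At Bt fAB; have := congr1 (fun i : 'I_n => i.+1) fAB.
  rewrite -[_.+1]/(#|v A|.-1.+1) -[in RHS]/(#|v B|.-1.+1) !prednK//.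
  exact: (chain_card_inj (@ncolored_inj _ _ c) ht At Bt).
have : #|~: (f @: t)| == 1%N.
  by rewrite cardsCs setCK card_ord (card_in_imset f_inj) -{1}tn subSnn.
case/cards1P => j fj; exists j.
  move=> R Rt; apply/eqP => Rj; have : f R \in f @: t by exact: imset_f.
  have -> : f R = j by apply: val_inj; rewrite -[LHS]/(#|v R|.-1) Rj.
  by apply/negP; have := set11 j; rewrite -fj inE.
move=> k /andP[k0 kn] kj.
have ltk : (k.-1 < n)%N by rewrite prednK.
have : Ordinal ltk \notin ~: (f @: t).
  by rewrite fj inE -val_eqE /= -eqSS prednK.
rewrite inE negbK => /imsetP[R Rt kR]; exists R => //.
have {}kR : k.-1 = #|v R|.-1 := congr1 val kR.
by rewrite -(prednK k0) kR prednK.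
Qed.

(** Only chains with exactly one gap matter. The gap is filled by the sets [a |: P] with [P] fixed
    and [l] summing to 0 over [P], so the balancing sum is the sum of [l] over the admissible
    [a]. *)
Lemma fundamental_weight_minkowski : minkowski fundamental_weight.
Proof.
split=> [t ht|t l bl lt0]; first by rewrite ffunE (negPf ht).
have [/andP[ht /eqP tn]|bad] := boolP (chain t && (#|t|.+1 == n)); last first.
  rewrite big1// => R Rt; rewrite ffunE cardsU1 Rt add1n.
  case: andP => [[hRt tn]|]; last by rewrite mul0r.
  case/negP: bad; rewrite tn andbT; apply: chainW hRt; exact: subsetUr.
have [j tj t_card] := missing_card ht tn.
pose ev (A : {set E}) := \sum_(e in A) l e.
(* [P] is the member just below the gap, or the empty set when the gap is at cardinality 1. *)
have [P [Pj evP Pc subP supP]] : exists P : {set E},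
    [/\ #|P| = j, ev P = 0, colored c P,
      (forall R, R \in t -> (#|v R| <= j)%N -> v R \subset P) &
      (forall R, chain (R |: t) -> (j < #|v R|)%N -> P \subset v R)].
  have [j0|j0] := eqVneq (j : nat) 0%N.
    exists set0; split=> //.
    - by rewrite cards0 j0.
    - by rewrite /ev big_set0.
    - by apply/coloredP => a b; rewrite inE.
    - by move=> R _; rewrite j0 leqn0 cards_eq0 => /eqP ->.
    - by move=> R _ _; rewrite sub0set.
  have [||P Pt Pj] := t_card j; first by rewrite lt0n j0 ltnW.
    by rewrite neq_ltn leqnn.
  exists (v P); split=> //.
  - exact: lt0.
  - exact: ncolored_colored.
  - by move=> R Rt Rj; apply: (chain_sub_card ht) => //; rewrite Pj.
  - move=> R hR jR; apply: (chain_sub_card hR); rewrite ?setU11 ?in_setU1 ?Pt ?orbT//.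
    by rewrite Pj ltnW.
(* [W] is the set of admissible [a]: the difference of the sets on both sides of the gap, on each of
   which [l] sums to 0, or, when the gap is at the top, the one block missed by [P], where
   balancedness of [l] is used. *)
have [W [evW WP WR RW]] : exists W : {set E},
    [/\ \sum_(a in W) l a = 0, (forall a, a \in W -> a \notin P /\ colored c (a |: P)),
      (forall R a, R \in t -> (j.+1 < #|v R|)%N -> a \in W -> a |: P \subset v R) &
      (forall R a, chain (R |: t) -> #|v R| = j.+1 -> a \in v R -> a \notin P -> a \in W)].
  have [ltj|gej] := ltnP j.+1 n.
    have [||Q Qt Qj] := t_card j.+2; first by rewrite ltj.
      by rewrite eqSS neq_ltn leqnn orbT.
    have PQ : P \subset v Q.
      by apply: supP; rewrite ?Qj// (setUidPr _) ?sub1set.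
    exists (v Q :\: P); split.
    - have := lt0 Q Qt; rewrite /pairing (big_setID P) /= (setIidPr PQ).
      by rewrite -/(ev P) evP add0r.
    - move=> a; rewrite inE => /andP[aP aQ]; split=> //.
      by apply: coloredW (ncolored_colored Q); rewrite subUset sub1set aQ.
    - move=> R a Rt Rj; rewrite inE => /andP[_ aQ].
      have /subsetP QR : v Q \subset v R by apply: (chain_sub_card ht) => //; rewrite Qj.
      by rewrite subUset sub1set QR//=; exact/(subset_trans PQ)/subsetP.
    - move=> R a hR Rj aR aP; rewrite inE aP /=; move: a aR {aP}; apply/subsetP.
      by apply: (chain_sub_card hR); rewrite ?setU11 ?in_setU1 ?Qt ?orbT// Rj Qj.
  have jn : j.+1 = n by apply/eqP; rewrite eqn_leq gej ltn_ord.
  have cPinj : {in P &, injective c} by exact/coloredP.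
  have : #|~: (c @: P)| == 1%N.
    by rewrite cardsCs setCK card_ord (card_in_imset cPinj) Pj -{1}jn subSnn.
  case/cards1P => i ci; have iP : i \notin c @: P.
    by have := set11 i; rewrite -ci inE.
  exists (block c i); split=> //.
  - move=> a; rewrite inE => /eqP ca; split.
      by apply: contra iP => aP; rewrite -ca imset_f.
    apply/coloredP => x y /setU1P[->|xP] /setU1P[->|yP] //; last exact: cPinj.
      by rewrite ca => iy; case/negP: iP; rewrite iy imset_f.
    by rewrite ca => xi; case/negP: iP; rewrite -xi imset_f.
  - by move=> R a _; rewrite ltnNge jn (colored_card (ncolored_colored R)).
  - move=> R a hR Rj aR aP; rewrite inE -in_set1 -ci inE.
    apply/imsetP => -[b bP cab].
    have bR : b \in v R by move: b bP {cab}; apply/subsetP/supP; rewrite ?Rj.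
    have /coloredP/(_ a b aR bR cab) ab := ncolored_colored R.
    by rewrite ab bP in aP.
pose A := [set a |: P | a in W].
have RA R : (R \notin t) && chain (R |: t) = (v R \in A).
  apply/andP/imsetP => [[Rt hR]|[a aW RE]].
    have Rj : #|v R| = j.+1.
      apply/eqP; apply: contraNT Rt => Rj.
      have [|//|Q Qt QR] := t_card #|v R|.
        by rewrite card_gt0 ncolored_neq0 (colored_card (ncolored_colored R)).
      have <- // : Q = R.
      by apply: (chain_card_inj (@ncolored_inj _ _ c) hR); rewrite ?setU11// in_setU1 Qt orbT.
    have PR : P \subset v R by apply: supP; rewrite ?Rj.
    have : #|v R :\: P| == 1%N by rewrite cardsD (setIidPr PR) Rj Pj subSnn.
    case/cards1P => a Ra; have : a \in v R :\: P by rewrite Ra set11.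
    rewrite inE => /andP[aP aR]; exists a; first exact: (RW R).
    by rewrite -Ra setUC setDE setUIr setUCr setIT; apply/esym/setUidPr.
  have [aP _] := WP a aW.
  have Rj : #|v R| = j.+1 by rewrite RE cardsU1 aP Pj.
  have Rt : R \notin t by apply/negP => /tj; rewrite Rj eqxx.
  split=> //; apply: chainU1 => // Q Qt; rewrite /comparable_sets.
  have [ltQ|gtQ|eQ] := ltngtP #|v Q| j.+1.
  - by rewrite orbC RE (subset_trans (subP Q Qt _)) ?subsetUr.
  - by rewrite RE WR.
  - by have := tj Q Qt; rewrite eQ eqxx.
transitivity (\sum_(R | v R \in A) ev (v R)).
  rewrite (bigID (fun R => chain (R |: t))) /= [X in _ + X]big1 ?addr0.
    apply: eq_big => [R|R /andP[Rt hR]]; first by rewrite RA.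
    by rewrite ffunE hR cardsU1 Rt add1n tn eqxx mul1r.
  by move=> R /andP[Rt /negPf hR]; rewrite ffunE hR mul0r.
have inA B : B \in A -> colored c B && (B != set0).
  case/imsetP => a aW ->; have [aP ->] := WP a aW.
  by apply/set0Pn; exists a; rewrite setU11.
have -> : \sum_(R | v R \in A) ev (v R) = \sum_(B in A) ev B.
  rewrite (@reindex_omap _ _ _ _ _ v insub (fun B => B \in A) ev).
    by apply: eq_bigl => R; rewrite valK eqxx andbT.
  by move=> B /inA BG; rewrite insubT.
rewrite big_imset /=; last first.
  move=> a b aW bW ab; have : a \in b |: P by rewrite -ab setU11.
  by have [/negPf aP _] := WP a aW; rewrite !inE aP orbF => /eqP.
under eq_bigr => a aW do rewrite /ev big_setU1 ?(proj1 (WP a aW))//= -/(ev P) evP addr0.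
exact: evW.
Qed.

End FundamentalWeight.

(** * The degree map *)

Module ChowRing.
Import mpoly.
Section ChowRing.
Local Open Scope ring_scope.
Variables (K : comNzRingType) (n : nat) (E : finType) (c : E -> 'I_n).

Local Notation G := (ncolored c).
Local Notation v := (val : G -> {set E}).
Local Notation N := #|G|.
Local Notation pi := (@chow_pi K n E c).

Lemma chow_pi_is_additive : GRing.nmod_morphism pi.
Proof. by split; [exact: raddf0|exact: raddfD]. Qed.

HB.instance Definition _ := GRing.isNmodMorphism.Build _ _ pi chow_pi_is_additive.

Lemma chow_pi_is_multiplicative : GRing.monoid_morphism pi.
Proof. by split; [exact: rmorph1|exact: rmorphM]. Qed.

HB.instance Definition _ := GRing.isMonoidMorphism.Build _ _ pi chow_pi_is_multiplicative.

Lemma chow_scalar_is_additive : GRing.nmod_morphism (@chow_scalar K n E c).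
Proof.
split; first by rewrite /chow_scalar /chow_cst mpolyC0 rmorph0.
by move=> a b; rewrite /chow_scalar /chow_cst mpolyCD rmorphD.
Qed.

Lemma chow_scalar_is_multiplicative : GRing.monoid_morphism (@chow_scalar K n E c).
Proof.
split; first by rewrite /chow_scalar /chow_cst mpolyC1 rmorph1.
by move=> a b; rewrite /chow_scalar /chow_cst mpolyCM rmorphM.
Qed.

HB.instance Definition _ := GRing.isNmodMorphism.Build _ _ (@chow_scalar K n E c)
  chow_scalar_is_additive.
HB.instance Definition _ := GRing.isMonoidMorphism.Build _ _ (@chow_scalar K n E c)
  chow_scalar_is_multiplicative.

Lemma chow_pi_eq0 p : (pi p == 0) = (p \in @chow_ideal K n E c).
Proof.
rewrite -[p in RHS]subr0 Quotient.idealrBE -[X in _ == X](rmorph0 pi).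
by [].
Qed.

Lemma chow_pi_gen p : chow_gen p -> pi p = 0.
Proof.
move=> gp; apply/eqP; rewrite chow_pi_eq0; apply/chow_idealP.
by rewrite -[p]mul1r -[_ * _]addr0; do !constructor.
Qed.

Lemma chow_x_incomparable (S S' : G) : ~~ comparable_sets v S S' ->
  chow_x K S * chow_x K S' = 0.
Proof.
rewrite /comparable_sets negb_or => /andP[SS' S'S].
rewrite -[LHS](rmorphM pi); apply: chow_pi_gen; exact: ChowIncomparable.
Qed.

Lemma chow_x_linear (e e' : E) : c e = c e' ->
  \sum_(S : G | e \in val S) chow_x K S = \sum_(S : G | e' \in val S) chow_x K S.
Proof.
have [->//|ee' ce] := eqVneq e e'.
apply/eqP; rewrite -subr_eq0 -!(rmorph_sum pi) -(rmorphB pi).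
apply/eqP/chow_pi_gen; exact: ChowLinear.
Qed.

Lemma chow_graded0 d : chow_graded K c d 0.
Proof. by exists 0; [exact: dhomog0|exact: rmorph0]. Qed.

Lemma chow_graded_lin d (a : K) u w : chow_graded K c d u -> chow_graded K c d w ->
  chow_graded K c d (chow_scalar c a * u + w).
Proof.
move=> [p hp <-] [q hq <-]; exists (a%:MP * p + q); last by rewrite rmorphD rmorphM.
by apply: dhomogD => //; rewrite mul_mpolyC dhomogZ.
Qed.

Lemma chow_graded_prod d (s : seq G) : size s = d ->
  chow_graded K c d (\prod_(S <- s) chow_x K S).
Proof.
move=> <-.
exists (\prod_(S <- s) chow_var K S); last by rewrite rmorph_prod.
rewrite /= /chow_homog; elim: s => [|S s IH]; first by rewrite big_nil dhomog1.
rewrite big_cons -[size _]/(1 + size s)%N; apply: dhomogM => //.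
by rewrite dhomogX /= mdeg1.
Qed.

Section Degree.
Variable lam : {set G} -> G -> E -> K.
Hypothesis lam_balanced : forall t S, chain v t -> S \in t -> balanced c (lam t S).
Hypothesis lam_dual : forall t S, chain v t -> S \in t ->
  {in t, forall R, pairing (lam t S) R = (R == S)%:R}.

Let W (s : seq G) := foldr (cap lam) (fundamental_weight K c) s.

Let W_minkowski s : minkowski (W s).
Proof.
elim: s => [|S s IH] /=; first exact: fundamental_weight_minkowski.
exact: minkowski_cap.
Qed.

Let W_mid s1 S s2 : W (s1 ++ S :: s2) = cap lam S (W (s1 ++ s2)).
Proof. by elim: s1 => //= S' s1 ->; rewrite capC. Qed.

Let W_perm s t : perm_eq s t -> W s = W t.
Proof.
elim: s t => [|S s IH] t; first by move/perm_size/esym/size0nil ->.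
move=> st; have : S \in t by rewrite -(perm_mem st) mem_head.
move=> St; case/splitPr: St st => t1 t2.
by rewrite perm_sym perm_catC /= perm_cons perm_catC perm_sym W_mid => /IH <-.
Qed.

(** A variable acts at a cone not containing it by adding its ray, so distinct letters outside [t]
    simply accumulate. *)
Let W_uniq s (t : {set G}) : uniq s -> {in s, forall S, S \notin t} ->
  W s t = fundamental_weight K c ([set S in s] :|: t).
Proof.
elim: s t => [|S s IH] t /=.
  by move=> _ _; congr (fundamental_weight K c _); apply/setP => S; rewrite !inE.
move=> /andP[Ss us] st; rewrite cap_notin ?st ?mem_head// IH//.
  by congr (fundamental_weight K c _); apply/setP => R; rewrite !inE orbCA orbA.
move=> R Rs; rewrite in_setU1 negb_or st ?in_cons ?Rs ?orbT// andbT.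
by apply: contraNneq Ss => <-.
Qed.

Let seqm (m : 'X_{1..N}) : seq G :=
  flatten [seq nseq (m i) (enum_val i) | i <- index_enum 'I_N].

Let seqmU m (S : G) : perm_eq (seqm (m + U_(enum_rank S))%MM) (S :: seqm m).
Proof.
apply/permP => p; rewrite /= /seqm !count_flatten -!map_comp !sumnE !big_map /=.
rewrite [LHS](bigD1 (enum_rank S)) // [X in _ = (_ + X)%N](bigD1 (enum_rank S)) //=.
rewrite mnmDE mnm1E eqxx enum_rankK !count_nseq mulnDr muln1 addnCA -addnA.
congr (_ + (_ + _))%N; apply: eq_bigr => i iS.
by rewrite !count_nseq mnmDE mnm1E [_ == i]eq_sym (negPf iS) addn0.
Qed.

(** Cutting off the monomials of degree above [n] makes the index type finite. This is compatible
    with the ideal because its generators are homogeneous. *)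
Let L (p : chow_poly K c) : K :=
  \sum_(m : 'X_{1..N < n.+1}) p@_m * W (seqm m) finset.set0.

Let L_lin a p q : L (a *: p + q) = a * L p + L q.
Proof.
rewrite /L mulr_sumr -big_split; apply: eq_bigr => m _ /=.
by rewrite mcoeffD mcoeffZ mulrDl mulrA.
Qed.

Let L0 : L 0 = 0.
Proof. by rewrite /L big1// => m _; rewrite mcoeff0 mul0r. Qed.

Let LZ a p : L (a *: p) = a * L p.
Proof. by have := L_lin a p 0; rewrite !addr0 L0 addr0. Qed.

Let LD p q : L (p + q) = L p + L q.
Proof. by rewrite -[p]scale1r L_lin mul1r scale1r. Qed.

Let L_sum I (r : seq I) (P : pred I) f :
  L (\sum_(i <- r | P i) f i) = \sum_(i <- r | P i) L (f i).
Proof. exact: (big_morph L LD L0). Qed.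

Let LX m : L 'X_[m] = if (mdeg m < n.+1)%N then W (seqm m) finset.set0 else 0.
Proof.
rewrite /L; case: ifPn => hm.
  rewrite (bigD1 (BMultinom hm)) //= mcoeffX eqxx mul1r big1 ?addr0// => k km.
  rewrite mcoeffX; case: eqP => [mk|]; last by rewrite mul0r.
  by case/eqP: km; apply: val_inj; rewrite /= -mk.
rewrite big1// => k _; rewrite mcoeffX; case: eqP => [mk|]; last by rewrite mul0r.
by move: hm; rewrite mk bmdeg.
Qed.

(** The first kind of generator acts by 0 by [cap_incomparable]. The second is the linear relation
    at the zero cone of the weight that is 1 at [e] and -1 at [e'], balanced since both lie in one
    block. *)
Let L_gen m g : chow_gen g -> L ('X_[m] * g) = 0.
Proof.
case=> [S S' SS' S'S|e e' ce ee'].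
  rewrite /chow_var mulrA -!mpolyXD LX; case: ifP => // _.
  have /W_perm -> : perm_eq (seqm (m + U_(enum_rank S) + U_(enum_rank S'))%MM)
                            (S' :: S :: seqm m).
    by rewrite (permPl (seqmU _ _)) perm_cons seqmU.
  rewrite /= cap_incomparable ?ffunE//.
  by rewrite /comparable_sets negb_or S'S.
have sumE (f : E) : L ('X_[m] * \sum_(S : G | f \in val S) chow_var K S) =
    if (mdeg m < n)%N then \sum_(S : G | f \in val S) W (S :: seqm m) finset.set0 else 0.
  rewrite mulr_sumr L_sum; case: ifPn => hm.
    apply: eq_bigr => S _; rewrite -mpolyXD LX mdegD mdeg1 addn1 ltnS hm.
    by rewrite (W_perm (seqmU _ _)).
  by rewrite big1// => S _; rewrite -mpolyXD LX mdegD mdeg1 addn1 ltnS (negPf hm).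
rewrite mulrBr -[X in _ + X]scaleN1r addrC L_lin !sumE; case: ifP => // _; last by rewrite mulr0 addr0.
pose l x : K := (x == e)%:R - (x == e')%:R.
have bl : balanced c l by move=> i; rewrite sumrB !sum_indicator !inE ce subrr.
have := cap_linear lam_balanced lam_dual finset.set0 (W_minkowski (seqm m)) bl.
move=> l0; rewrite mulN1r addrC -[RHS]l0; under [RHS]eq_bigr do rewrite /pairing sumrB !sum_indicator mulrBr.
rewrite sumrB; congr (_ - _); rewrite big_mkcond; apply: eq_bigr => S _ /=;
  by case: ifP; rewrite ?mulr1 ?mulr0.
Qed.

Let L_ideal p : p \in @chow_ideal K n E c -> L p = 0.
Proof.
move/chow_idealP; elim=> [|a g q gg _ IH]; first exact: L0.
rewrite LD IH addr0 [a]mpolyE mulr_suml L_sum big1_seq// => m _.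
by rewrite -scalerAl LZ L_gen// mulr0.
Qed.

Let L_pi p q : pi p = pi q -> L p = L q.
Proof.
move=> pq; rewrite -[p](subrK q) LD L_ideal ?add0r//.
by rewrite -chow_pi_eq0 rmorphB /= pq subrr.
Qed.

(** Since [L] kills the ideal, it can be evaluated on any representative. On a product along a full
    chain the letters accumulate to a maximal cone, where the fundamental weight is 1. *)
Lemma degree_map_of_weights : exists D : chow K c -> K,
  (forall a u w, D (chow_scalar c a * u + w) = a * D u + D w) /\
  (forall S : 'I_n -> G,
     (forall i j : 'I_n, (i < j)%N -> val (S i) \proper val (S j)) ->
     D (\prod_(i < n) chow_x K (S i)) = 1).
Proof.
exists (fun u => L (repr u)).
have LE p : L (repr (pi p)) = L p by apply: L_pi; exact: reprK.
split=> [a u w|S S_lt].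
  rewrite -[in LHS](reprK u) -[in LHS](reprK w).
  rewrite -[X in L (repr X)]/(pi (chow_cst c a) * pi (repr u) + pi (repr w)).
  by rewrite -(rmorphM pi) -(rmorphD pi) [LHS]LE /chow_cst mul_mpolyC L_lin.
rewrite -(rmorph_prod pi) [LHS]LE mprodXE LX.
set m := (\big[_/_]_(i <- _) _)%MM.
have -> : (mdeg m < n.+1)%N.
  by rewrite mdeg_sum (eq_bigr (fun=> 1%N)) ?sum1_card ?card_ord// => i _; rewrite mdeg1.
have /W_perm -> : perm_eq (seqm m) [seq S i | i <- index_enum 'I_n].
  rewrite /m; elim: (index_enum _) => [|i r IH].
    rewrite big_nil; apply/permP => p.
    rewrite /seqm count_flatten -map_comp sumnE big_map big1//= => j _.
    by rewrite count_nseq mnm0E muln0.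
  by rewrite big_cons addmC (permPl (seqmU _ _)) perm_cons.
have S_inj : injective S.
  move=> i j Sij; apply: val_inj; case: (ltngtP i j) => // /S_lt;
  by rewrite Sij properxx.
rewrite W_uniq; first last.
- by move=> R _; rewrite inE.
- by rewrite map_inj_uniq// index_enum_uniq.
rewrite setU0 ffunE; have -> : [set R in [seq S i | i <- index_enum 'I_n]] = S @: 'I_n.
  apply/setP => R; rewrite inE; apply/mapP/imsetP => -[i _ ->]; exists i => //.
  by rewrite mem_index_enum.
rewrite card_imset// card_ord eqxx andbT.
suff -> : chain v (S @: 'I_n) by [].
apply/chainP => _ _ /imsetP[i _ ->] /imsetP[j _ ->]; rewrite /comparable_sets.
by case: (ltngtP i j) => [/S_lt/proper_sub->|/S_lt/proper_sub->|/val_inj->];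
  rewrite ?orbT ?subxx.
Qed.

End Degree.

Lemma degree_map_exists : (forall i, (1 < #|block c i|)%N) ->
  exists D : chow K c -> K,
  (forall a u w, D (chow_scalar c a * u + w) = a * D u + D w) /\
  (forall S : 'I_n -> G,
     (forall i j : 'I_n, (i < j)%N -> val (S i) \proper val (S j)) ->
     D (\prod_(i < n) chow_x K (S i)) = 1).
Proof.
move=> block_gt1.
have /choice[lam lamP] : forall tS : {set G} * G, exists l : E -> K,
    chain v tS.1 -> tS.2 \in tS.1 ->
    balanced c l /\ {in tS.1, forall R, pairing l R = (R == tS.2)%:R}.
  move=> [t S] /=.
  have [/andP[ht St]|] := boolP (chain v t && (S \in t)); last first.
    by move=> h; exists (fun=> 0) => ht St; rewrite ht St in h.
  by have [l l1 l2] := dual_balanced_weight K block_gt1 ht St; exists l.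
apply: (@degree_map_of_weights (fun t S => lam (t, S))) => t S ht St;
  by have [] := lamP (t, S) ht St.
Qed.

End ChowRing.
End ChowRing.
Export ChowRing.

Section LinearForm.
Local Open Scope ring_scope.
Variables (K B : comNzRingType) (kap : {rmorphism K -> B}) (L : B -> K).
Hypothesis L_lin : forall a u w, L (kap a * u + w) = a * L u + L w.

Lemma linD u w : L (u + w) = L u + L w.
Proof. by rewrite -[u]mul1r -(rmorph1 kap) L_lin mul1r rmorph1 mul1r. Qed.

Lemma lin0 : L 0 = 0.
Proof. by have := linD 0 0; rewrite addr0 => /eqP; rewrite addrC -subr_eq subrr => /eqP. Qed.

Lemma linZ a u : L (kap a * u) = a * L u.
Proof. by rewrite -[_ * _]addr0 L_lin lin0 addr0. Qed.

Lemma lin_sum I (r : seq I) (P : pred I) f :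
  L (\sum_(i <- r | P i) f i) = \sum_(i <- r | P i) L (f i).
Proof. exact: (big_morph L linD lin0). Qed.

End LinearForm.

(** * Retractions onto maximal colored sets *)

Section Retraction.
Local Open Scope ring_scope.
Variables (K : comNzRingType) (n : nat) (E : finType) (c : E -> 'I_n).
Hypothesis block_gt1 : forall i, (1 < #|block c i|)%N.

Local Notation G := (ncolored c).
Local Notation v := (val : G -> {set E}).
Local Notation x := (@chow_x K n E c).
Local Notation kap := (@chow_scalar K n E c).

(** The linear relation replaces [e] by another element [e'] of its block. No set containing [e'] is
    comparable with [S], as the larger of the two would contain both [e] and [e']. *)
Lemma chow_hyper_x (e : E) (S : G) : e \in v S ->
  (\sum_(R : G | e \in v R) x R) * x S = 0.
Proof.
move=> eS; have [e' /andP[/eqP ce ee']] := block_other (block_gt1 (c e)).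
rewrite (chow_x_linear K (esym ce)) mulr_suml big1// => R e'R.
apply: chow_x_incomparable; apply/negP => /orP[/subsetP RS|/subsetP SR].
  have /coloredP/(_ e' e (RS _ e'R) eS ce) := ncolored_colored S.
  exact/eqP.
have /coloredP/(_ e' e e'R (SR _ eS) ce) := ncolored_colored R.
exact/eqP.
Qed.

(** This is the class [rho_T^* x_Y], for the retraction taking a colored set to its trace on [T]. *)
Definition pullback (T : {set E}) (Y : G) : chow K c :=
  \sum_(S : G | v S :&: T == v Y) x S.

Lemma pullback_incomparable T (Y Q : G) : ~~ comparable_sets v Y Q ->
  pullback T Y * pullback T Q = 0.
Proof.
move=> YQ; rewrite mulr_suml big1// => S /eqP SY; rewrite mulr_sumr big1// => S' /eqP SQ.
apply: chow_x_incomparable; apply: contra YQ; rewrite /comparable_sets -SY -SQ.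
by move=> /orP[h|h]; rewrite (setSI _ h) ?orbT.
Qed.

Lemma sum_pullback_weighted T (a : {set E} -> chow K c) : a set0 = 0 ->
  \sum_Y a (v Y) * pullback T Y = \sum_S a (v S :&: T) * x S.
Proof.
move=> a0; under eq_bigr do rewrite mulr_sumr.
rewrite (exchange_big_dep xpredT) //=; apply: eq_bigr => S _.
have [ST|ST] := eqVneq (v S :&: T) set0.
  by rewrite big1 ?ST ?a0 ?mul0r// => Y /eqP YE; rewrite -YE a0 mul0r.
have hST : colored c (v S :&: T) && (v S :&: T != set0).
  by rewrite ST andbT; apply: coloredW (ncolored_colored S); exact: subsetIl.
by rewrite (big_pred1 (Sub (v S :&: T) hST)).
Qed.

Lemma sum_pullback T (e : E) : \sum_(Y : G | e \in v Y) pullback T Y =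
  if e \in T then \sum_(S : G | e \in v S) x S else 0.
Proof.
have := @sum_pullback_weighted T (fun A => (e \in A)%:R).
rewrite inE => /(_ erefl) h; rewrite big_mkcond.
under eq_bigr do rewrite -mulrb -mulr_natl.
rewrite h; case: ifP => eT; last first.
  by rewrite big1// => S _; rewrite inE eT andbF mul0r.
by rewrite [RHS]big_mkcond; apply: eq_bigr => S _; rewrite inE eT andbT mulr_natl mulrb.
Qed.

Lemma hyper_pullback T (e : E) (Q : G) : e \in v Q ->
  (\sum_(Y : G | e \in v Y) pullback T Y) * pullback T Q = 0.
Proof.
move=> eQ; rewrite sum_pullback; case: ifP => _; last by rewrite mul0r.
rewrite mulr_sumr big1// => S /eqP SQ; rewrite chow_hyper_x//.
by move: eQ; rewrite -SQ inE => /andP[].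
Qed.

Lemma max_colored_card T : max_colored c T -> #|T| = n.
Proof.
case/andP => /coloredP cT /forallP hT; rewrite -(card_in_imset cT) -[RHS]card_ord.
rewrite -cardsT; congr #|pred_of_set _|; apply/setP => i; rewrite inE.
have /set0Pn[e] := hT i; rewrite !inE => /andP[eT /eqP <-].
by rewrite imset_f.
Qed.

Lemma colored_card_max (S : G) : #|v S| = n -> max_colored c (v S).
Proof.
move=> Sn; rewrite /max_colored ncolored_colored /=; apply/forallP => i.
have /coloredP cS := ncolored_colored S.
have : i \in c @: v S.
  have -> : c @: v S = setT by apply/eqP; rewrite eqEcard subsetT cardsT card_ord card_in_imset// Sn leqnn.
  by rewrite inE.
by case/imsetP => e eS ->; apply/set0Pn; exists e; rewrite !inE eS eqxx.
Qed.

(** A set comparable with a set of [n] elements is contained in it and equals its own trace, so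
    [x T] kills every term of the pullback except [x Y]. *)
Lemma top_pullback (T Y : G) : #|v T| = n -> v Y \subset v T ->
  x T * pullback (v T) Y = x T * x Y.
Proof.
move=> Tn YT; rewrite /pullback (bigD1 Y); last by apply/eqP/setIidPl.
rewrite mulrDr mulr_sumr big1 ?addr0// => S /andP[/eqP SY SneY].
apply: chow_x_incomparable; apply: contra SneY => /orP[TS|ST].
  have ES : S = T.
    apply/ncolored_inj/eqP; rewrite eq_sym eqEcard TS Tn.
    exact: colored_card (ncolored_colored S).
  by apply/eqP/ncolored_inj; rewrite -SY ES setIid.
by apply/eqP/ncolored_inj; rewrite -SY; apply/esym/setIidPl.
Qed.

Lemma top_prod_pullback (T : G) (s : seq G) : #|v T| = n -> T \in s ->
    {in s, forall Y, v Y \subset v T} ->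
  \prod_(Y <- s) pullback (v T) Y = \prod_(Y <- s) x Y.
Proof.
move=> Tn Ts sT.
have TT : pullback (v T) T = x T.
  rewrite /pullback (big_pred1 T)// => S /=; apply/eqP/eqP => [ST|->]; last exact: setIid.
  apply/ncolored_inj/eqP; rewrite eq_sym eqEcard Tn (colored_card (ncolored_colored S)) andbT.
  exact/setIidPr.
rewrite !(perm_big _ (perm_to_rem Ts)) !big_cons /= TT.
have : {in rem T s, forall Y, v Y \subset v T} by move=> Y /mem_rem/sT.
elim: (rem T s) => [|Y r IH] hr; first by rewrite !big_nil.
have hr' : {in r, forall Z, v Z \subset v T} by move=> Z Zr; apply: hr; rewrite in_cons Zr orbT.
rewrite !big_cons mulrA (top_pullback Tn (hr _ (mem_head _ _))).
by rewrite mulrAC (IH hr') mulrAC mulrA.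
Qed.

Lemma chain_sort (C : seq G) : (0 < n)%N -> uniq C -> chain v [set Q in C] ->
    size C = n ->
  exists S : 'I_n -> G, [/\ perm_eq C [seq S i | i <- enum 'I_n],
    (forall i j : 'I_n, (i < j)%N -> v (S i) \proper v (S j)) &
    exists2 T, T \in C & #|v T| = n /\ {in C, forall Q, v Q \subset v T}].
Proof.
move=> n0 uC hC sC; have [Q0 _] : exists Q0, Q0 \in C.
  by case: C sC {uC hC} => [sC|Q C _]; [rewrite -sC in n0|exists Q; rewrite mem_head].
pose le (A B : G) := (#|v A| <= #|v B|)%N.
have le_total : total le by move=> A B; exact: leq_total.
have le_trans : transitive le by move=> A B D; exact: leq_trans.
pose s := sort le C; have ss : size s = n by rewrite size_sort.
have us : uniq s by rewrite sort_uniq.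
pose S (i : 'I_n) := nth Q0 s i.
have SC i : S i \in C by rewrite -(mem_sort le); apply: mem_nth; rewrite ss.
have S_perm : perm_eq C [seq S i | i <- enum 'I_n].
  rewrite perm_sym; have -> : [seq S i | i <- enum 'I_n] = s; last by rewrite perm_sort.
  rewrite /S (map_comp (nth Q0 s) val) val_enum_ord.
  by have := mkseq_nth Q0 s; rewrite /mkseq ss.
have S_lt (i j : 'I_n) : (i < j)%N -> v (S i) \proper v (S j).
  move=> ij; have leS : le (S i) (S j).
    apply: (sorted_leq_nth le_trans _ Q0 (sort_sorted le_total C)); rewrite ?inE ?ss//.
    - by move=> A; exact: leqnn.
    - exact: ltnW.
  rewrite properEneq (chain_sub_card hC) ?inE// andbT.
  apply/eqP => /ncolored_inj/eqP; rewrite nth_uniq ?ss//.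
  by rewrite eqn_leq [(j <= i)%N]leqNgt ij andbF.
exists S; split=> //.
have n1 : (n.-1 < n)%N by rewrite prednK.
pose top := Ordinal n1; exists (S top) => //; split.
  apply/eqP; rewrite eqn_leq (colored_card (ncolored_colored _)) /=.
  (* Strict inclusions force the cardinalities to grow by at least one, so the last of the [n] sets
     has [n] elements. *)
  suff H (i : 'I_n) : (i < #|v (S i)|)%N by have := H top; rewrite /= prednK.
  case: i => i; elim: i => [|i IH] hi; first by rewrite card_gt0 ncolored_neq0.
  by apply: leq_ltn_trans (IH (ltnW hi)) _; apply: proper_card; exact: S_lt.
move=> Q; rewrite (perm_mem S_perm) => /mapP[i _ ->].
have [ni|ni] := ltnP i n.-1; first exact/proper_sub/S_lt.
have -> // : i = top.
by apply/val_inj/eqP; rewrite /= eqn_leq ni -ltnS prednK// ltn_ord.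
Qed.

Lemma expr_sum_distr (B : comNzRingType) (k : {rmorphism K -> B}) (a : G -> K)
    (y : G -> B) m :
  (\sum_S k (a S) * y S) ^+ m =
  \sum_(g : {ffun 'I_m -> G}) k (\prod_i a (g i)) * \prod_i y (g i).
Proof.
rewrite -[X in _ ^+ X](card_ord m) -prodr_const (bigA_distr_bigA (fun _ : 'I_m => fun S => k (a S) * y S)) /=.
by apply: eq_bigr => g _; rewrite big_split /= rmorph_prod.
Qed.

Section DegreeMaps.
Variables (f L : chow K c -> K).
Hypothesis n_gt0 : (0 < n)%N.
Hypothesis f_degree : is_degree_map f.
Hypothesis L_lin : forall a u w, L (kap a * u + w) = a * L u + L w.
Hypothesis L_chain : forall S : 'I_n -> G,
  (forall i j : 'I_n, (i < j)%N -> v (S i) \proper v (S j)) ->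
  L (\prod_(i < n) x (S i)) = 1.

Lemma degree_map0 : f 0 = 0.
Proof.
have := f_degree.1 (-1) 0 0 (chow_graded0 _ _ _) (chow_graded0 _ _ _).
by rewrite mulr0 addr0 mulN1r addNr.
Qed.

Lemma degree_map_sum (I : eqType) (r : seq I) (a : I -> K) (u : I -> chow K c) :
    (forall i, i \in r -> chow_graded K c n (u i)) ->
  chow_graded K c n (\sum_(i <- r) kap (a i) * u i) /\
  f (\sum_(i <- r) kap (a i) * u i) = \sum_(i <- r) a i * f (u i).
Proof.
elim: r => [|i r IH] hu; first by rewrite !big_nil degree_map0; split=> //; exact: chow_graded0.
rewrite !big_cons; have [|g1 f1] := IH; first by move=> j jr; apply: hu; rewrite in_cons jr orbT.
have gi := hu i (mem_head _ _).
by split; [exact: chow_graded_lin|rewrite f_degree.1// f1].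
Qed.

Let L0 := lin0 L_lin.
Let LZ := linZ L_lin.
Let L_sum := lin_sum L_lin.

(** The defect of the identity to be shown, in the form required by [chain_span], whose hypotheses
    concern words of every length; hence the value 0 off length [n]. *)
Let F (s : seq G) : K := if size s == n then f (\prod_(Y <- s) x Y) -
  \sum_(T : {set E} | max_colored c T) L (\prod_(Y <- s) pullback T Y) else 0.

Let F0 s : \prod_(Y <- s) x Y = 0 ->
  (forall T, \prod_(Y <- s) pullback T Y = 0) -> F s = 0.
Proof.
move=> h1 h2; rewrite /F; case: ifP => // _; rewrite h1 degree_map0 big1 ?subr0//.
by move=> T _; rewrite h2 L0.
Qed.

(* The right-hand side is again a degree map, and degree maps are determined by
   their values on chains. *)
Lemma degree_map_split s : size s = n -> f (\prod_(Y <- s) x Y) =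
  \sum_(T : {set E} | max_colored c T) L (\prod_(Y <- s) pullback T Y).
Proof.
move=> sn; suff : F s = 0 by rewrite /F sn eqxx => /eqP; rewrite subr_eq0 => /eqP.
move: s sn; apply: (@chain_span _ _ v (@ncolored_inj _ _ c) _ F [::] n) => //.
- move=> s t st; rewrite /F (perm_size st); case: ifP => // _.
  rewrite (perm_big _ st); congr (_ - _).
  by apply: eq_bigr => T _; rewrite (perm_big _ st).
- move=> R Q s; rewrite cats0 => Qs RQ; apply: F0 => [|T];
    rewrite big_cons (perm_big _ (perm_to_rem Qs)) big_cons mulrA.
    by rewrite chow_x_incomparable ?mul0r.
  by rewrite pullback_incomparable ?mul0r.
- by move=> R s R0; have := ncolored_neq0 R; rewrite R0 eqxx.
- move=> a Q s; rewrite cats0 => Qs aQ.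
  rewrite /F /=; case: eqP => sn; last by rewrite big1.
  rewrite sumrB exchange_big /= [X in _ - X]big1 ?subr0; last first.
    move=> T _; rewrite -L_sum -[RHS]L0; congr L.
    under eq_bigr do rewrite big_cons; rewrite -mulr_suml.
    by rewrite (perm_big _ (perm_to_rem Qs)) big_cons mulrA hyper_pullback ?mul0r.
  have := @degree_map_sum _ (index_enum G) (fun R => (a \in v R)%:R)
    (fun R => \prod_(Y <- R :: s) x Y).
  case=> [R _|_]; first exact: chow_graded_prod.
  under [X in f X = _]eq_bigr do rewrite rmorph_nat mulr_natl mulrb big_cons.
  under [X in _ = X]eq_bigr do rewrite mulr_natl mulrb.
  rewrite -!big_mkcond /= => <-; rewrite -mulr_suml.
  by rewrite (perm_big _ (perm_to_rem Qs)) big_cons mulrA chow_hyper_x ?mul0r ?degree_map0.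
- by apply/chainP => ?; rewrite inE.
- move=> C; rewrite cats0 => uC hC sC.
  have [S [S_perm S_lt [T TC [Tn CT]]]] := chain_sort n_gt0 uC hC sC.
  have CE : \prod_(Y <- C) x Y = \prod_(i < n) x (S i).
    by rewrite (perm_big _ S_perm) big_map big_enum.
  (* On a full chain with top [T] only the summand of [T] survives: no set has trace [T] on another
     maximal colored set. *)
  rewrite /F sC eqxx CE f_degree.2// (bigD1 (v T)) ?colored_card_max//=.
  rewrite top_prod_pullback// CE L_chain// big1 ?addr0 ?subrr// => T' /andP[T'm T'T].
  rewrite (perm_big _ (perm_to_rem TC)) big_cons.
  suff -> : pullback T' T = 0 by rewrite /= mul0r L0.
  rewrite /pullback big_pred0// => R; apply/negbTE; apply: contra T'T => /eqP RT.
  by rewrite eq_sym eqEcard -RT subsetIr RT Tn (max_colored_card T'm) leqnn.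
Qed.

(** As [f] is only known to be linear in degree [n], the power is first expanded into monomials of
    that degree. *)
Lemma degree_map_div_split (a : {set E} -> K) :
  f ((\sum_(S : G) kap (a (v S)) * x S) ^+ n) =
  \sum_(T : {set E} | max_colored c T)
    L ((\sum_(S : G) kap (a (v S)) * pullback T S) ^+ n).
Proof.
rewrite expr_sum_distr.
have enumE (y : G -> chow K c) (g : {ffun 'I_n -> G}) :
    \prod_i y (g i) = \prod_(Y <- [seq g i | i <- enum 'I_n]) y Y.
  by rewrite big_map big_enum.
have sz (g : {ffun 'I_n -> G}) : size [seq g i | i <- enum 'I_n] = n.
  by rewrite size_map size_enum_ord.
have [g _|_ ->] := @degree_map_sum _ (index_enum {ffun 'I_n -> G})
    (fun g => \prod_i a (v (g i))) (fun g => \prod_i x (g i)).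
  by rewrite enumE; exact: chow_graded_prod.
under [RHS]eq_bigr do rewrite expr_sum_distr L_sum.
rewrite [RHS]exchange_big /=; apply: eq_bigr => g _.
rewrite enumE degree_map_split// mulr_sumr; apply: eq_bigr => T _.
by rewrite LZ enumE.
Qed.

End DegreeMaps.
End Retraction.

(** * Slicing a polymatroid in the ring *)

Section LocalRing.
Local Open Scope ring_scope.

Lemma big_set_split (V : zmodType) (I : finType) (k : I) (f : {set I} -> V) :
  \sum_A f A = \sum_(A : {set I} | k \notin A) (f A + f (k |: A)).
Proof.
rewrite (bigID (fun A : {set I} => k \notin A)) /= big_split; congr (_ + _).
rewrite (reindex_onto (fun A => k |: A) (fun A => A :\ k)) /=.
  apply: eq_bigl => A; rewrite setU11 /=.
  apply/eqP/idP => [<-|kA]; first by rewrite setD11.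
  by rewrite setU1K.
by move=> A; rewrite negbK => kA; rewrite setD1K.
Qed.

Record polymatroid (R : realDomainType) (I : finType) (v : {set I} -> R) : Prop :=
  Polymatroid {
    pm_set0 : v set0 = 0;
    pm_mono : forall A B : {set I}, A \subset B -> v A <= v B;
    pm_submod : forall A B, v (A :|: B) + v (A :&: B) <= v A + v B }.

Variables (R : realDomainType) (n : nat) (B : comNzRingType) (kap : {rmorphism R -> B}).
Variable rho : {set 'I_n} -> B.

Definition hyper (i : 'I_n) : B := \sum_(A : {set 'I_n} | i \in A) rho A.

(** Multiplication by this product restricts to the coordinates of index at least [k]: it kills
    [rho A] as soon as [A] contains a smaller index. *)
Definition hyper_lt (k : nat) : B := \prod_(i < n | (i < k)%N) hyper i.

Definition div_of (a : {set 'I_n} -> R) : B := \sum_A kap (a A) * rho A.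

Hypothesis rho_incomparable : forall A A' : {set 'I_n},
  ~~ (A \subset A') -> ~~ (A' \subset A) -> rho A * rho A' = 0.
Hypothesis hyper_rho : forall i (A : {set 'I_n}), i \in A -> hyper i * rho A = 0.

Lemma hyper_ltS (k : 'I_n) : hyper_lt k.+1 = hyper_lt k * hyper k.
Proof.
rewrite /hyper_lt (bigD1 k) ?ltnS//= mulrC; congr (_ * _).
by apply: eq_bigl => i; rewrite ltnS [RHS]ltn_neqAle andbC.
Qed.

Lemma hyper_lt_rho k (i : 'I_n) (A : {set 'I_n}) : (i < k)%N -> i \in A -> hyper_lt k * rho A = 0.
Proof. by move=> ik iA; rewrite /hyper_lt (bigD1 i)//= mulrAC hyper_rho// mul0r. Qed.

(** The hyperplanes are traded for flag members one by one, from the last to the first. Among the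
    sets containing [k], those with a smaller index are killed by [hyper_lt k], and those missing a
    larger index are incomparable with the next flag member; only the set of all indices at least
    [k] remains. *)
Lemma hyper_lt_flag : hyper_lt n = \prod_(l < n) rho [set i : 'I_n | (l <= i)%N].
Proof.
pose P k := \prod_(l < n | (k <= l)%N) rho [set i : 'I_n | (l <= i)%N].
have step (k : 'I_n) : hyper_lt k.+1 * P k.+1 = hyper_lt k * P k.
  rewrite {2}/P (bigD1 k)//= hyper_ltS.
  have -> : \prod_(l < n | (k <= l)%N && (l != k)) rho [set i : 'I_n | (l <= i)%N] = P k.+1.
    by apply: eq_bigl => l; rewrite [in RHS]ltn_neqAle andbC [l == k]eq_sym.
  have -> : hyper_lt k * hyper k * P k.+1 = hyper_lt k * P k.+1 * hyper k by ring.
  rewrite [hyper k](bigD1 [set i : 'I_n | (k <= i)%N]) ?inE//= mulrDr.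
  rewrite [X in _ + X]mulr_sumr big1 ?addr0; first by ring.
  move=> A /andP[kA Ak].
  have [/subsetP sA|/subsetPn[i iA]] := boolP (A \subset [set i : 'I_n | (k <= i)%N]); last first.
    by rewrite inE -ltnNge => ik; rewrite mulrAC (hyper_lt_rho ik iA) mul0r.
  have /subsetPn[i] : ~~ ([set i : 'I_n | (k <= i)%N] \subset A).
    by apply: contra Ak => Ak; rewrite eqEsubset Ak; apply/andP; split=> //; exact/subsetP.
  rewrite inE => ki iA; have {}ki : (k < i)%N.
    by rewrite ltn_neqAle ki andbT; apply: contraNneq iA => /val_inj <-.
  have k1 : (k.+1 < n)%N by exact: leq_ltn_trans (ltn_ord i).
  rewrite /P (bigD1 (Ordinal k1)) ?leqnn//= [rho _ * _]mulrC -!mulrA rho_incomparable ?mulr0//.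
    by apply/subsetPn; exists i => //; rewrite inE.
  by apply/subsetPn; exists k => //; rewrite inE ltnn.
have all k : (k <= n)%N -> hyper_lt k * P k = hyper_lt 0 * P 0%N.
  by elim: k => // k IH kn; rewrite (step (Ordinal kn)) IH// ltnW.
have := all n (leqnn n); rewrite /P [X in _ * X = _]big1 ?mulr1.
  by move=> ->; rewrite /hyper_lt big_pred0 ?mul1r.
by move=> l; rewrite leqNgt ltn_ord.
Qed.

Lemma mul_expr_eq (z x y : B) m : z * x = z * y -> z * x ^+ m = z * y ^+ m.
Proof. by move=> zxy; elim: m => // m IH; rewrite !exprS mulrCA IH mulrCA mulrA zxy mulrA. Qed.

Lemma expr_sum_vanish m (z : B) (a : {set 'I_n} -> R) (xi : {set 'I_n} -> B) :
    (forall s, size s = m -> z * \prod_(Y <- s) xi Y = 0) ->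
  z * (\sum_Y kap (a Y) * xi Y) ^+ m = 0.
Proof.
elim: m z => [|m IH] z hz; first by have := hz [::] erefl; rewrite big_nil.
rewrite exprS mulrA mulr_sumr mulr_suml big1// => Y _.
rewrite mulrCA -mulrA IH ?mulr0// => s sm.
by have := hz (Y :: s); rewrite big_cons /= sm mulrA => ->.
Qed.

Lemma chain_card_le (J : {set 'I_n}) (C : seq {set 'I_n}) : uniq C ->
    chain id [set Q in C] -> {in C, forall Q, (Q != set0) && (Q \subset J)} ->
  (size C <= #|J|)%N.
Proof.
move=> uC hC CJ; rewrite -(size_map (fun Q : {set 'I_n} => #|Q|)) -(size_iota 1 #|J|).
apply: uniq_leq_size.
  rewrite map_inj_in_uniq// => Q Q' QC Q'C.
  by apply: (chain_card_inj (@inj_id _) hC); rewrite inE.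
move=> _ /mapP[Q /CJ/andP[Q0 QJ] ->]; rewrite mem_iota card_gt0 Q0 add1n ltnS.
exact: subset_leq_card.
Qed.

(** * Projection along one coordinate *)

Section Slice.
Variable k : 'I_n.
Let J := [set i : 'I_n | (k < i)%N].

(** The pullback of the variable of [Y] along the projection forgetting the coordinate [k]. It is
    cut off to nonempty subsets of [J], as smaller indices are killed by [hyper_lt k]. *)
Definition fiber (Y : {set 'I_n}) : B :=
  if (Y != set0) && (Y \subset J) then rho Y + rho (k |: Y) else 0.

Let J_k (Y : {set 'I_n}) : Y \subset J -> k \notin Y.
Proof. by move=> /subsetP YJ; apply/negP => /YJ; rewrite inE ltnn. Qed.

Let hyper_lt_notin (Y : {set 'I_n}) : ~~ (Y \subset J) -> k \notin Y ->
  hyper_lt k * rho Y = 0.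
Proof.
case/subsetPn => i iY; rewrite inE -leqNgt leq_eqVlt => /orP[/eqP/val_inj ik|ik _].
  by rewrite -ik iY.
exact: hyper_lt_rho iY.
Qed.

Let hyper_lt_notinU (Y : {set 'I_n}) : ~~ (Y \subset J) -> k \notin Y ->
  hyper_lt k * rho (k |: Y) = 0.
Proof.
case/subsetPn => i iY; rewrite inE -leqNgt leq_eqVlt => /orP[/eqP/val_inj ik|ik _].
  by rewrite -ik iY.
by apply: (hyper_lt_rho ik); rewrite in_setU1 iY orbT.
Qed.

Let subU (Y Q : {set 'I_n}) : k \notin Y -> (Y \subset k |: Q) = (Y \subset Q).
Proof.
move=> kY; apply/idP/idP => [/subsetP h|/subset_trans]; last by apply; exact: subsetUr.
apply/subsetP => i iY; have /setU1P[ik|//] := h i iY.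
by rewrite -ik iY in kY.
Qed.

Let Usub (Y Q : {set 'I_n}) : k |: Y \subset Q -> Y \subset Q.
Proof. exact/subset_trans/subsetUr. Qed.

Let fiberU (Y : {set 'I_n}) : fiber (k |: Y) = 0.
Proof. by rewrite /fiber; case: ifP => // /andP[_ /J_k]; rewrite setU11. Qed.

Lemma rho_fiber_incomparable (Y Q : {set 'I_n}) : Q \subset J ->
    ~~ comparable_sets id Y Q ->
  rho Q * fiber Y = 0 /\ rho (k |: Q) * fiber Y = 0.
Proof.
move=> QJ; rewrite /comparable_sets negb_or => /andP[YQ QY]; rewrite /fiber.
case: ifP => [/andP[_ YJ]|_]; last by rewrite !mulr0.
have [kY kQ] := (J_k YJ, J_k QJ); rewrite !mulrDr !rho_incomparable ?addr0//;
  by [rewrite subU|apply: contra QY => /Usub; rewrite ?subU|apply: contra YQ => /Usub; rewrite ?subU].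
Qed.

Lemma fiber_incomparable (Y Q : {set 'I_n}) : ~~ comparable_sets id Y Q ->
  fiber Y * fiber Q = 0.
Proof.
move=> YQ; rewrite {2}/fiber; case: ifP => [/andP[_ QJ]|_]; last by rewrite mulr0.
by have [h1 h2] := rho_fiber_incomparable QJ YQ; rewrite mulrDr ![fiber Y * _]mulrC h1 h2 addr0.
Qed.

Lemma hyper_fiber i (Q : {set 'I_n}) : i \in Q -> hyper i * fiber Q = 0.
Proof.
move=> iQ; rewrite /fiber; case: ifP => _; last by rewrite mulr0.
by rewrite mulrDr !hyper_rho ?addr0// in_setU1 iQ orbT.
Qed.

(** The sets containing [a] pair up as [Y] and [k |: Y]. Each pair is a fiber, or is killed by
    [hyper_lt k]. *)
Lemma sum_fiber (a : 'I_n) : a \in J ->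
  hyper_lt k * \sum_(Y : {set 'I_n} | a \in Y) fiber Y = hyper_lt k * hyper a.
Proof.
move=> aJ; have ak : a != k by apply: contraTneq aJ => ->; rewrite inE ltnn.
rewrite /hyper big_mkcond [in RHS]big_mkcond /= !(big_set_split k) !mulr_sumr.
apply: eq_bigr => Y kY; rewrite in_setU1 (negPf ak) /=.
have [aY|aY] := boolP (a \in Y); last by [].
rewrite fiberU.
have Y0 : Y != set0 by apply/set0Pn; exists a.
rewrite addr0 /fiber Y0 /=; case: ifPn => // YJ.
by rewrite mulr0 mulrDr hyper_lt_notin// hyper_lt_notinU// addr0.
Qed.

Let star_vanish z (a : 'I_n) (s : seq {set 'I_n}) :
    z * hyper a = 0 -> a \in J ->
  \sum_(Y : {set 'I_n} | a \in Y) hyper_lt k * z * \prod_(X <- Y :: s) fiber X = 0.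
Proof.
move=> za aJ; under eq_bigr do rewrite big_cons.
transitivity (hyper_lt k * (\sum_(Y : {set 'I_n} | a \in Y) fiber Y) * (z * \prod_(X <- s) fiber X)).
  by rewrite mulr_sumr mulr_suml; apply: eq_bigr => Y _; ring.
by rewrite sum_fiber//; transitivity (hyper_lt k * \prod_(X <- s) fiber X * (z * hyper a));
  [ring|rewrite za mulr0].
Qed.

Let prod_fiber_in (Q : {set 'I_n}) s : Q \in s ->
  \prod_(X <- s) fiber X = fiber Q * \prod_(X <- rem Q s) fiber X.
Proof. by move=> Qs; rewrite (perm_big _ (perm_to_rem Qs)) big_cons. Qed.

(* The fibers generate a ring of dimension #|J|. *)
Lemma prod_fiber_vanish s : size s = #|J|.+1 ->
  hyper_lt k * \prod_(Y <- s) fiber Y = 0.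
Proof.
apply: (@chain_span _ _ id (@inj_id _) _ (fun s => hyper_lt k * \prod_(Y <- s) fiber Y) [::]) => //.
- by move=> s1 s2 s12; rewrite (perm_big _ s12).
- move=> X Q s1; rewrite cats0 => Qs XQ.
  by rewrite big_cons (prod_fiber_in Qs) [fiber X * _]mulrA fiber_incomparable// mul0r mulr0.
- by move=> X s1 ->; rewrite big_cons /fiber eqxx mul0r mulr0.
- move=> a Q s1; rewrite cats0 => Qs aQ; under eq_bigr do rewrite big_cons (prod_fiber_in Qs).
  rewrite (eq_bigr (fun Y => hyper_lt k * fiber Q * \prod_(X <- Y :: rem Q s1) fiber X)).
    have [aJ|aJ] := boolP (a \in J); first by apply: star_vanish => //; rewrite mulrC hyper_fiber.
    rewrite big1// => Y aY; rewrite big_cons.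
    have -> : fiber Y = 0; last by rewrite mul0r mulr0.
    by rewrite /fiber; case: ifP => // /andP[_ /subsetP/(_ a aY)]; rewrite (negPf aJ).
  by move=> Y _; rewrite big_cons; ring.
- by apply/chainP => ?; rewrite inE.
- move=> C; rewrite cats0 => uC hC sC.
  have [/allP CJ|/allPn[Q QC QJ]] := boolP (all (fun Q => (Q != set0) && (Q \subset J)) C).
    by have := chain_card_le uC hC CJ; rewrite sC ltnn.
  by rewrite (prod_fiber_in QC) {1}/fiber (negPf QJ) mul0r mulr0.
Qed.

(** The factor [rho (k |: Y0)] behaves like one more fiber, with [Y0] as the fixed chain of
    [chain_span]; a chain of nonempty subsets of [J] has at most [#|J|] members. *)
Lemma rho_prod_fiber_vanish (Y0 : {set 'I_n}) s : Y0 != set0 -> Y0 \subset J ->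
  size s = #|J| -> hyper_lt k * rho (k |: Y0) * \prod_(Y <- s) fiber Y = 0.
Proof.
move=> Y00 Y0J.
have k0 a : a \in Y0 -> rho (k |: Y0) * hyper a = 0.
  by move=> aY0; rewrite mulrC hyper_rho// in_setU1 aY0 orbT.
apply: (@chain_span _ _ id (@inj_id _) _
  (fun s => hyper_lt k * rho (k |: Y0) * \prod_(Y <- s) fiber Y) [:: Y0]) => //.
- by move=> s1 s2 s12; rewrite (perm_big _ s12).
- move=> X Q s1; rewrite mem_cat inE => /orP[Qs|/eqP ->] XQ.
    by rewrite big_cons (prod_fiber_in Qs) [fiber X * _]mulrA fiber_incomparable// mul0r mulr0.
  have [_ h] := rho_fiber_incomparable Y0J XQ.
  by rewrite big_cons mulrA -[_ * rho _ * _]mulrA h mulr0 mul0r.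
- by move=> X s1 ->; rewrite big_cons /fiber eqxx mul0r mulr0.
- move=> a Q s1 Qs aQ; have [aJ|aJ] := boolP (a \in J); last first.
    rewrite big1// => Y aY; rewrite big_cons.
    have -> : fiber Y = 0; last by rewrite mul0r mulr0.
    by rewrite /fiber; case: ifP => // /andP[_ /subsetP/(_ a aY)]; rewrite (negPf aJ).
  move: Qs; rewrite mem_cat inE => /orP[Qs|/eqP QY0]; last first.
    by apply: star_vanish => //; rewrite k0// -QY0.
  rewrite (eq_bigr (fun Y => hyper_lt k * (rho (k |: Y0) * fiber Q) *
      \prod_(X <- Y :: rem Q s1) fiber X)).
    by apply: star_vanish => //; rewrite -mulrA [fiber Q * _]mulrC hyper_fiber// mulr0.
  by move=> Y _; rewrite !big_cons (prod_fiber_in Qs); ring.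
- by move=> Q; rewrite inE => /eqP ->.
- by apply/chainP => ? ?; rewrite !inE => /eqP -> /eqP ->; rewrite comparable_setsxx.
- move=> C uC hC sC.
  have [/allP CJ|/allPn[Q QC QJ]] := boolP (all (fun Q => (Q != set0) && (Q \subset J)) C).
    suff : (size (C ++ [:: Y0]) <= #|J|)%N by rewrite size_cat /= addn1 sC ltnn.
    apply: chain_card_le => // Q; rewrite mem_cat inE => /orP[/CJ//|/eqP ->].
    by rewrite Y00.
  by rewrite (prod_fiber_in QC) {1}/fiber (negPf QJ) mul0r mulr0.
Qed.

Variable v : {set 'I_n} -> R.
Hypothesis v_pm : polymatroid v.

Definition slice (t : R) (Y : {set 'I_n}) : R := Num.min (v Y) (v (k |: Y) - t).

Definition trunc (t : R) (X : {set 'I_n}) : R :=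
  if k \in X then Num.min (v X) (v (X :\ k) + t) else v X.

Lemma slice_polymatroid t : t <= v [set k] -> polymatroid (slice t).
Proof.
move=> tk; split.
- by rewrite /slice setU0 (pm_set0 v_pm) (min_idPl _) ?subr_ge0.
- move=> A C sAC; rewrite /slice le_min !ge_min (pm_mono v_pm sAC) /= orbC lerD2r.
  by rewrite (pm_mono v_pm) ?setUS.
move=> A C; rewrite /slice setUUr setUIr.
have subm := pm_submod v_pm; have mono := pm_mono v_pm.
have h1 := subm A C; have h2 := subm (k |: A) (k |: C).
have h3 := subm A (k |: C); have h4 := subm (k |: A) C.
have e3 : A :|: (k |: C) = k |: A :|: (k |: C) by apply/setP => i; rewrite !inE; case: (i == k); case: (i \in A); case: (i \in C).
have e4 : k |: A :|: C = k |: A :|: (k |: C) by apply/setP => i; rewrite !inE; case: (i == k); case: (i \in A); case: (i \in C).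
rewrite e3 in h3; rewrite e4 in h4.
have m3 : v (A :&: C) <= v (A :&: (k |: C)) by apply/mono/setIS/subsetUr.
have m4 : v (A :&: C) <= v ((k |: A) :&: C) by apply/mono/setSI/subsetUr.
(* When the two minima are attained differently, the union is bounded through the sets with [k] and
   the intersection through the sets without it. *)
case: (leP (v A) (v (k |: A) - t)) => _; case: (leP (v C) (v (k |: C) - t)) => _.
- by apply: le_trans h1; rewrite lerD// ge_min lexx.
- by apply: (@le_trans _ _ (v (k |: A :|: (k |: C)) - t + v (A :&: C)));
    [rewrite lerD// ge_min lexx ?orbT|lra].
- by apply: (@le_trans _ _ (v (k |: A :|: (k |: C)) - t + v (A :&: C)));
    [rewrite lerD// ge_min lexx ?orbT|lra].
- by apply: (@le_trans _ _ (v (k |: A :|: (k |: C)) - t + (v ((k |: A) :&: (k |: C)) - t)));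
    [rewrite lerD// ge_min lexx ?orbT|lra].
Qed.

Lemma marginal_le (Y X : {set 'I_n}) : k \notin Y -> k \in X -> Y \subset X ->
  v X - v (X :\ k) <= v (k |: Y) - v Y.
Proof.
move=> kY kX YX; have := pm_submod v_pm (X :\ k) (k |: Y).
have -> : X :\ k :|: (k |: Y) = X.
  by rewrite setUA [_ :|: [set k]]setUC setD1K//; apply/setUidPl.
have -> : (X :\ k) :&: (k |: Y) = Y.
  apply/setP => i; rewrite !inE; have [->|ik] /= := eqVneq i k.
    by rewrite (negPf kY).
  by case: (boolP (i \in Y)) => iY; rewrite ?andbF// (subsetP YX).
by move=> ?; lra.
Qed.

Definition div_fiber (a : {set 'I_n} -> R) : B := \sum_Y kap (a Y) * fiber Y.

(** A divisor whose coefficients ignore [k] is a pullback along the projection. The condition at the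
    empty set accounts for the pair of the empty set and [[set k]], which is no fiber. *)
Lemma hyper_lt_div (a a' : {set 'I_n} -> R) : a' set0 = 0 ->
    (forall Y : {set 'I_n}, k \notin Y -> a Y = a' Y /\ a (k |: Y) = a' Y) ->
  hyper_lt k * div_of a = hyper_lt k * div_fiber a'.
Proof.
move=> a0 aa'; rewrite /div_of /div_fiber !(big_set_split k) !mulr_sumr.
apply: eq_bigr => Y kY; have [-> ->] := aa' Y kY.
rewrite fiberU.
rewrite mulr0 addr0 -mulrDr /fiber; have [->|Y0] /= := eqVneq Y set0.
  by rewrite a0 rmorph0 !mul0r mulr0.
case: ifPn => // YJ; rewrite mulrCA mulrDr.
by rewrite hyper_lt_notin// hyper_lt_notinU// !addr0 !mulr0.
Qed.

Lemma hyper_lt_div0 :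
  hyper_lt k * div_of (fun X => v (X :\ k)) ^+ #|J|.+1 = 0.
Proof.
have E : hyper_lt k * div_of (fun X => v (X :\ k)) = hyper_lt k * div_fiber v.
  apply: hyper_lt_div => [|Y kY]; first exact: pm_set0.
  rewrite setU1K//; split=> //; congr v; apply/setP => i; rewrite !inE.
  by case: eqP => // ->; rewrite (negPf kY).
by rewrite (mul_expr_eq _ E); apply: expr_sum_vanish; exact: prod_fiber_vanish.
Qed.

Section Marginal.
Variables (t : R) (U : {set {set 'I_n}}).
Hypothesis t_le : t <= v [set k].
Hypothesis U_k : forall X : {set 'I_n}, X \in U -> k \in X.
Hypothesis k_U : [set k] \in U.
Hypothesis U_marginal : forall X : {set 'I_n}, X \in U -> t <= v X - v (X :\ k).

(** The set [U] is kept abstract because two choices are needed: the sets whose marginal at [k] is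
    at least [t], and those where it exceeds [t]. They give the left and right derivatives of the
    truncated divisor. *)
Let alpha := \sum_(X in U) rho X.

Let alpha_hyper : alpha * hyper k = 0.
Proof.
by rewrite mulr_suml big1// => X XU; rewrite mulrC hyper_rho// U_k.
Qed.

(** Marginals decrease as sets grow: if adding [k] to [Y] gains less than [t], no [X] in [U]
    contains [Y]. *)
Let alpha_rho (Y : {set 'I_n}) : k \notin Y -> v (k |: Y) - t < v Y -> alpha * rho Y = 0.
Proof.
move=> kY vY; rewrite mulr_suml big1// => X XU; rewrite rho_incomparable//.
  by apply: contra kY => /subsetP; apply; exact: U_k.
apply/negP => YX; have := marginal_le kY (U_k XU) YX.
move=> /(le_trans (U_marginal XU)); rewrite lerBrDr => h.
by move: vY; rewrite ltrBlDr ltNge addrC h.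
Qed.

(** On the terms that [alpha] does not kill, the truncation is [slice t Y] at [Y], and it is
    [slice t Y + t] at [k |: Y]. The extra [t] contributes a multiple of [hyper k], which [alpha]
    kills, and the rest is a pullback. *)
Let hyper_lt_alpha_div :
  hyper_lt k * alpha * div_of (trunc t) = hyper_lt k * alpha * div_fiber (slice t).
Proof.
have -> : hyper_lt k * alpha * div_fiber (slice t) =
    alpha * (hyper_lt k * div_fiber (slice t)) by ring.
rewrite -(@hyper_lt_div (fun X => if k \in X then slice t (X :\ k) else slice t X)).
- rewrite [RHS]mulrCA mulrA; suff E : alpha * div_of (trunc t) =
      alpha * div_of (fun X => if k \in X then slice t (X :\ k) else slice t X).
    by rewrite -!mulrA E.
  rewrite /div_of !(big_set_split k).
  transitivity (alpha * \sum_(Y : {set 'I_n} | k \notin Y)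
      (kap (slice t Y) * rho Y + kap (slice t Y + t) * rho (k |: Y))).
    rewrite !mulr_sumr; apply: eq_bigr => Y kY; rewrite /trunc (negPf kY) setU11 setU1K//.
    have -> : Num.min (v (k |: Y)) (v Y + t) = slice t Y + t.
      by rewrite /slice addr_minl subrK minC.
    rewrite !mulrDr; congr (_ + _); rewrite ![alpha * (_ * _)]mulrCA.
    have [h|h] := leP (v Y) (v (k |: Y) - t); first by rewrite /slice (min_idPl h).
    by rewrite alpha_rho// !mulr0.
  transitivity (alpha * \sum_(Y : {set 'I_n} | k \notin Y)
      (kap (slice t Y) * rho Y + kap (slice t Y) * rho (k |: Y)) + kap t * (alpha * hyper k)).
    have -> : hyper k = \sum_(Y : {set 'I_n} | k \notin Y) rho (k |: Y).
      rewrite /hyper big_mkcond (big_set_split k); apply: eq_bigr => Y kY.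
      by rewrite (negPf kY) setU11 add0r.
    rewrite mulrCA -mulrDr; congr (_ * _); rewrite mulr_sumr -big_split /=.
    by apply: eq_bigr => Y _; rewrite rmorphD mulrDl addrA.
  rewrite alpha_hyper mulr0 addr0; congr (_ * _); apply: eq_bigr => Y kY.
  by rewrite setU11 (negPf kY) setU1K.
- exact/pm_set0/slice_polymatroid.
- by move=> Y kY; rewrite setU11 (negPf kY) setU1K.
Qed.

(** The difference [hyper k - alpha] only involves sets containing [k] and some other element,
    because [[set k]] is in [U]; such terms vanish against [#|J|] fibers. *)
Let hyper_lt_alpha_fiber a : hyper_lt k * alpha * div_fiber a ^+ #|J| =
  hyper_lt k.+1 * div_fiber a ^+ #|J|.
Proof.
apply/eqP; rewrite hyper_ltS eq_sym -subr_eq0 -mulrBl -mulrBr.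
have -> : hyper k - alpha = \sum_(X : {set 'I_n} | (k \in X) && (X \notin U)) rho X.
  rewrite /hyper (bigID (fun X => X \in U)) /= addrC; apply/eqP.
  rewrite subr_eq; apply/eqP; congr (_ + _); apply: eq_bigl => X.
  by case: (boolP (X \in U)) => [/U_k ->|]; rewrite ?andbF.
rewrite mulr_sumr mulr_suml big1// => X /andP[kX XU].
have [XJ|] := boolP (X :\ k \subset J); last first.
  case/subsetPn => i; rewrite !inE => /andP[ik iX]; rewrite -leqNgt leq_eqVlt.
  rewrite val_eqE (negPf ik) /= => ltik.
  by rewrite (hyper_lt_rho ltik)// mul0r.
apply: expr_sum_vanish => s sJ; rewrite -(setD1K kX) rho_prod_fiber_vanish//.
apply/eqP => X0; move: XU; rewrite -(setD1K kX) X0 setU0.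
by rewrite k_U.
Qed.

(* Intersecting with alpha is projecting along the coordinate k: the polymatroid
   truncated at height t becomes the slice at height t. *)
Lemma marginal_slice : hyper_lt k * alpha * div_of (trunc t) ^+ #|J| =
  hyper_lt k.+1 * div_of (slice t) ^+ #|J|.
Proof.
rewrite (mul_expr_eq _ hyper_lt_alpha_div) hyper_lt_alpha_fiber; apply: mul_expr_eq.
rewrite /div_fiber /div_of !(big_set_split k) !mulr_sumr; apply: eq_bigr => Y kY.
rewrite fiberU.
have kr : hyper_lt k.+1 * rho (k |: Y) = 0 by rewrite (hyper_lt_rho (ltnSn k)) ?setU11.
rewrite !mulrDr ![hyper_lt _ * (_ * _)]mulrCA kr !mulr0 !addr0.
have [->|Y0] := eqVneq Y set0.
  by rewrite (pm_set0 (slice_polymatroid t_le)) rmorph0 !mul0r.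
rewrite /fiber Y0 /=; case: ifPn => YJ; first by rewrite mulrDr kr addr0.
suff -> : hyper_lt k.+1 * rho Y = 0 by rewrite !mulr0.
by rewrite hyper_ltS mulrAC hyper_lt_notin// mul0r.
Qed.

End Marginal.
End Slice.
End LocalRing.

From mathcomp Require Import all_classical all_reals all_analysis.
Import numFieldNormedType.Exports.

(** * Slicing a volume *)

Section LebesgueTuple.
Local Open Scope ring_scope.
Local Open Scope classical_set_scope.
Variable R : realType.
Local Notation tup m := (m.-tuple (measurableTypeR R)).

Lemma lebesgue_tupleS m (A : set (tup m.+1)) : lebesgue_tuple A =
  (\int[lebesgue_measure]_x lebesgue_tuple [set t : tup m | A [tuple of x :: t]])%E.
Proof.
rewrite /= /pushforward /product_measure1; apply: eq_integral => x _ /=.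
congr lebesgue_tuple; apply/seteqP; split=> t; rewrite /xsection /= ?inE//.
Qed.

Lemma lebesgue_tuple0 m : lebesgue_tuple (set0 : set (tup m)) = 0%E.
Proof.
elim: m => [|m IH]; first by rewrite /= dirac0.
by rewrite lebesgue_tupleS; under eq_integral do rewrite IH; rewrite integral0.
Qed.

(** Fubini over the first coordinate, followed by the fundamental theorem of calculus; the
    degenerate interval is treated apart. *)
Lemma lebesgue_tuple_slices m (A : set (tup m.+1)) (b : R) (Psi F : R -> R) : 0 <= b ->
    (forall x : R, 0 <= x <= b ->
      lebesgue_tuple [set t : tup m | A [tuple of x :: t]] = (Psi x)%:E) ->
    (forall (x : R) (t : tup m), A [tuple of x :: t] -> 0 <= x <= b) ->
    continuous Psi -> continuous F ->
    (forall x : R, 0 < x < b -> is_derive x 1 F (Psi x)) ->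
  lebesgue_tuple A = (F b - F 0)%:E.
Proof.
move=> b0 APsi A0 cPsi cF dF; rewrite lebesgue_tupleS.
transitivity (\int[lebesgue_measure]_(x in `[0%R, b]) (Psi x)%:E)%E.
  rewrite [RHS]integral_mkcond; apply: eq_integral => x _; rewrite patchE.
  have [x0|x0] := boolP (0 <= x <= b).
    by rewrite mem_set ?APsi//= in_itv.
  rewrite memNset /= ?in_itv/=; last exact/negP.
  rewrite (_ : [set t | _] = set0) ?lebesgue_tuple0//.
  by rewrite -subset0 => t /= /A0; exact/negP.
have [bE|bn0] := eqVneq b 0; first by rewrite bE set_itv1 integral_set1 subrr.
have {}b0 : 0 < b by rewrite lt_def bn0.
rewrite (@continuous_FTC2 _ Psi F)//.
- exact: continuous_subspaceT.
- split=> [x||].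
  + rewrite in_itv => /dF ?; exact: ex_derive.
  + exact/cvg_at_right_filter/cF.
  + exact/cvg_at_left_filter/cF.
- by move=> x; rewrite in_itv => /dF ?; rewrite derive1E derive_val.
Qed.

Lemma lebesgue_tuple_simplex m (r : R) : 0 <= r ->
  lebesgue_tuple [set t : tup m | (forall i, (i < m)%N -> 0 <= nth 0 t i) /\
    \sum_(i < m) nth 0 t i <= r] = (r ^+ m / m`!%:R)%:E.
Proof.
elim: m r => [|m IH] r r0.
  rewrite /= diracE mem_set ?fact0 ?divr1//=; split=> //.
  by rewrite big_ord0.
have m1 : m.+1`!%:R != 0 :> R by rewrite pnatr_eq0 -lt0n fact_gt0.
have m0 : m`!%:R != 0 :> R by rewrite pnatr_eq0 -lt0n fact_gt0.
pose F (x : R) := - ((r - x) ^+ m.+1 / m.+1`!%:R).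
have -> : r ^+ m.+1 / m.+1`!%:R = F r - F 0.
  by rewrite /F subrr subr0 expr0n /= mul0r oppr0 sub0r opprK.
apply: (@lebesgue_tuple_slices _ _ r (fun x => (r - x) ^+ m / m`!%:R)) => //.
- move=> x /andP[x0 xr]; rewrite -IH ?subr_ge0//; congr lebesgue_tuple.
  apply/seteqP; split=> t /= [t0 tr]; (split; last first).
  + by move: tr; rewrite big_ord_recl /= => tr; rewrite lerBrDl.
  + by move=> i im; have := t0 i.+1; apply.
  + by rewrite big_ord_recl /= -lerBrDl.
  + by case=> // i; rewrite ltnS; exact: t0.
- move=> x t /= [t0 tr]; have x0 := t0 0%N isT; rewrite x0 /=.
  apply: le_trans tr; rewrite big_ord_recl /= lerDl sumr_ge0// => i _.
  by have := t0 i.+1; apply; rewrite ltnS.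
- move=> x; apply: cvgM; last exact: cvg_cst.
  apply: (@continuous_comp _ _ _ (fun y : R => r - y) (fun y => y ^+ m)).
    by apply: cvgB; [exact: cvg_cst|exact: cvg_id].
  exact: exprn_continuous.
- move=> x; apply: cvgN; apply: cvgM; last exact: cvg_cst.
  apply: (@continuous_comp _ _ _ (fun y : R => r - y) (fun y => y ^+ m.+1)).
    by apply: cvgB; [exact: cvg_cst|exact: cvg_id].
  exact: exprn_continuous.
- move=> x _; have d1 : is_derive x 1 (fun y : R => r - y) (- 1).
    by rewrite -[- 1]add0r; apply: is_deriveB.
  have -> : F = (- (m.+1`!%:R)^-1) *: (fun y : R => r - y) ^+ m.+1.
    by apply/funext => y; rewrite /F !fctE mulrC -mulNr.
  apply: (is_derive_eq (is_deriveZ _ _)).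
  rewrite factS natrM /GRing.scale /=; field.
  by rewrite m0 addrC natr1 pnatr_eq0.
Qed.

End LebesgueTuple.

Section Region.
Local Open Scope ring_scope.
Variables (R : realType) (n : nat).

(* The coordinates of index at least n - m of a point of a polymatroid. *)
Definition region (m : nat) (v : {set 'I_n} -> R) : set (m.-tuple (measurableTypeR R)) :=
  [set t : m.-tuple (measurableTypeR R) | (forall i, (i < m)%N -> 0 <= nth 0 t i) /\
    forall A : {set 'I_n}, A \subset [set i : 'I_n | (n - m <= i)%N]%SET ->
      \sum_(i in A) nth 0 t (i - (n - m)) <= v A]%classic.

Arguments region m v _ : clear implicits.

Lemma card_ord_gt (k : 'I_n) : #|[set i : 'I_n | (k < i)%N]%SET| = (n - k.+1)%N.
Proof.
rewrite cardE /enum_mem -enumT size_filter.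
have -> : count (mem [set i : 'I_n | (k < i)%N]%SET) (enum 'I_n) =
    count (ltn k) [seq val i | i <- enum 'I_n].
  by rewrite count_map; apply: eq_count => i /=; rewrite inE.
rewrite val_enum_ord; move: (nat_of_ord k) (ltn_ord k) => j jn.
rewrite -{1}(subnKC jn) iotaD count_cat.
rewrite (eq_in_count (a2 := pred0)) ?count_pred0 ?add0n; last first.
  by move=> i; rewrite mem_iota add0n ltnS /= ltnNge => ->.
rewrite (eq_in_count (a2 := predT)) ?count_predT ?size_iota// => i.
by rewrite mem_iota => /andP[].
Qed.

(** With the coordinate [k] fixed at [x], the inequalities of [A] and of [k |: A] bound the same sum
    over [A]; together they are the minimum defining [slice]. *)
Lemma region_cons (m : nat) (v : {set 'I_n} -> R) (x : R)
    (t : m.-tuple (measurableTypeR R)) (k : 'I_n) : (n - m.+1)%N = k -> (m < n)%N ->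
  v finset.set0 = 0 ->
  region m.+1 v [tuple of x :: t] <-> 0 <= x <= v [set k]%SET /\ region m (slice k v x) t.
Proof.
move=> nk mn v0; have nk1 : (n - m)%N = k.+1 by rewrite -nk subnSK.
have sumE (A : {set 'I_n}) : A \subset [set i : 'I_n | (k < i)%N]%SET ->
    \sum_(i in A) nth 0 (x :: t) (i - k) = \sum_(i in A) nth 0 t (i - k.+1).
  move=> /fintype.subsetP Ak; apply: eq_bigr => i /Ak; rewrite inE => ki.
  by rewrite -(subnSK ki).
have kA (A : {set 'I_n}) : A \subset [set i : 'I_n | (k < i)%N]%SET -> k \notin A.
  by move=> /fintype.subsetP Ak; apply/negP => /Ak; rewrite inE ltnn.
have sumU (A : {set 'I_n}) : A \subset [set i : 'I_n | (k < i)%N]%SET ->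
    \sum_(i in k |: A) nth 0 (x :: t) (i - k) = x + \sum_(i in A) nth 0 t (i - k.+1).
  by move=> Ak; rewrite big_setU1 ?kA//= subnn sumE.
rewrite /region /= nk nk1; split=> [[t0 tA]|[/andP[x0 xk] [t0 tA]]].
  split; first (apply/andP; split).
  - exact: (t0 0%N).
  - have := tA [set k]%SET; rewrite finset.sub1set inE leqnn => /(_ isT).
    by rewrite big_set1 subnn.
  split=> [i im|A Ak]; first exact: (t0 i.+1).
  have Ak' : A \subset [set i : 'I_n | (k <= i)%N]%SET.
    by apply: fintype.subset_trans Ak _; apply/fintype.subsetP => i; rewrite !inE => /ltnW.
  rewrite /slice le_min; apply/andP; split; first by rewrite -sumE// tA.
  rewrite lerBrDl -sumU// tA// finset.subUset Ak' finset.sub1set inE leqnn//.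
split=> [[//|i im]|X Xk]; first exact: t0.
have [kX|kX] := boolP (k \in X).
  have Xk1 : X :\ k \subset [set i : 'I_n | (k < i)%N]%SET.
    apply/fintype.subsetP => i; rewrite !inE => /andP[ik /(fintype.subsetP Xk)].
    by rewrite inE ltn_neqAle => ->; rewrite andbT eq_sym.
  rewrite -(finset.setD1K kX) sumU//; have := tA _ Xk1; rewrite /slice le_min => /andP[_].
  by rewrite lerBrDl.
have Xk1 : X \subset [set i : 'I_n | (k < i)%N]%SET.
  apply/fintype.subsetP => i iX; have := fintype.subsetP Xk i iX.
  rewrite !inE ltn_neqAle => ->; rewrite andbT; apply: contraNneq kX => ki.
  by have -> : k = i by exact: val_inj.
by rewrite sumE//; have := tA _ Xk1; rewrite /slice le_min => /andP[].
Qed.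

End Region.
Arguments region {R n} m v _.

(** * Volume of a polymatroid as a degree *)

Section LocalVolume.
Local Open Scope ring_scope.
Variables (R : realType) (n : nat) (B : comNzRingType) (kap : {rmorphism R -> B}).
Variables (L : B -> R) (rho : {set 'I_n} -> B).
Hypothesis L_lin : forall a u w, L (kap a * u + w) = a * L u + L w.
Hypothesis rho_incomparable : forall A A' : {set 'I_n},
  ~~ (A \subset A') -> ~~ (A' \subset A) -> rho A * rho A' = 0.
Hypothesis hyper_rho : forall i (A : {set 'I_n}), i \in A -> hyper rho i * rho A = 0.

Local Notation D := (div_of kap rho).
Local Notation H := (hyper_lt rho).

Let L0 := lin0 L_lin.
Let LZ := linZ L_lin.
Let L_sum := lin_sum L_lin.

(** The ring [B] carries no topology, so one factor at a time is expanded and its coefficients are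
    taken out of [L]; this is why [w] varies in the induction. *)
Lemma continuous_pow_div (a : R -> {set 'I_n} -> R) w N :
    (forall X, continuous (fun s => a s X)) ->
  continuous (fun s => L (w * D (a s) ^+ N)).
Proof.
move=> ca; elim: N w => [|N IH] w; first by under eq_fun do rewrite expr0; exact: cst_continuous.
have -> : (fun s => L (w * D (a s) ^+ N.+1)) =
    (fun s => \sum_X a s X * L (w * rho X * D (a s) ^+ N)).
  apply/funext => s; rewrite exprS mulrA {1}/div_of mulr_sumr mulr_suml L_sum.
  by apply: eq_bigr => X _; rewrite [w * _]mulrCA -[in LHS]mulrA LZ.
have cX (X : {set 'I_n}) : xpredT X ->
    continuous (fun s => a s X * L (w * rho X * D (a s) ^+ N)).
  by move=> _ s; apply: cvgM; [exact: ca|exact: IH].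
exact: (continuous_big (@add_continuous R^o) cX).
Qed.

(** A first order Taylor formula read off from the binomial expansion: the terms of degree at least
    2 in [t] form the remainder. *)
Lemma pow_expansion (w d al : B) N : exists C, forall t, `|t| <= 1 ->
  `|L (w * (d + kap t * al) ^+ N.+1) - L (w * d ^+ N.+1)
     - t * (N.+1%:R * L (w * al * d ^+ N))| <= C * t ^+ 2.
Proof.
pose f i := L (w * (d ^+ (N.+1 - i) * al ^+ i *+ 'C(N.+1, i))).
exists (\sum_(i < N) `|f i.+2|) => t t1.
have -> : L (w * (d + kap t * al) ^+ N.+1) = \sum_(i < N.+2) t ^+ i * f i.
  rewrite exprDn mulr_sumr L_sum; apply: eq_bigr => i _.
  rewrite -LZ exprMn -rmorphXn /= [d ^+ _ * (_ * _)]mulrCA -mulrnAr.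
  by rewrite [w * (_ * _)]mulrCA.
rewrite !big_ord_recl /= /bump /= addn0.
have -> : f 0%N = L (w * d ^+ N.+1) by rewrite /f subn0 expr0 mulr1 bin0.
have -> : f 1%N = N.+1%:R * L (w * al * d ^+ N).
  by rewrite /f subn1 expr1 bin1 /= mulrnAr -mulr_natl -(rmorph_nat kap) LZ mulrA mulrAC.
set S := \sum_(i < N) _; have -> : forall x y : R, t ^+ 0 * x + (t ^+ 1 * y + S) - x - t * y = S.
  by move=> x y; rewrite expr0 expr1; ring.
rewrite /S.
apply: le_trans (ler_norm_sum _ _ _) _; rewrite mulr_suml; apply: ler_sum => i _.
rewrite !add1n normrM mulrC ler_wpM2l// -[i.+2]add2n exprD normrM.
rewrite [`|t ^+ 2|]ger0_norm ?sqr_ge0// ler_piMr ?sqr_ge0//.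
by rewrite normrX exprn_ile1.
Qed.

Lemma is_derive_quadratic (F : R -> R) (s l : R) :
    (exists delta C, 0 < delta /\
      forall t, `|t| < delta -> `|F (s + t) - F s - t * l| <= C * t ^+ 2) ->
  is_derive s 1 F l.
Proof.
move=> [delta [C [d0 HC]]].
suff cv : ((fun h : R => h^-1 *: (F (h *: 1 + s) - F s)) @ 0^' --> l)%classic.
  apply: DeriveDef; first by apply/cvg_ex; exists l.
  exact/cvg_lim.
apply/cvgrPdist_le => e e0; near=> h.
have h0 : h != 0 by near: h; exact: nbhs_dnbhs_neq.
have hd : `|h| < delta by near: h; apply: dnbhs0_lt.
have he : `|h| < e / (`|C| + 1).
  by near: h; apply: dnbhs0_lt; rewrite divr_gt0// ltr_wpDl.
rewrite -[l](mulKf h0) -mulrBr normrM normrV ?unitfE//.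
rewrite ler_pdivrMl ?normr_gt0// distrC [h *: 1]mulr1 [h + s]addrC.
apply: le_trans (HC h hd) _; rewrite -real_normK ?num_real// expr2 mulrA mulrC.
rewrite ler_wpM2l//; apply: (@le_trans _ _ ((`|C| + 1) * `|h|)).
  by rewrite ler_wpM2r// (le_trans (ler_norm C))// lerDl.
by rewrite mulrC -ler_pdivlMr ?ltr_wpDl// ltW.
Unshelve. all: by end_near. Qed.

Section Derivative.
Variables (v : {set 'I_n} -> R) (k : 'I_n).
Hypothesis v_pm : polymatroid v.
Local Notation m := #|[set i : 'I_n | (k < i)%N]%SET|.

(** Each value of the truncation is piecewise linear in the height, with a break where the height
    equals the marginal of [k]. At the break the slope is 0 to the right and 1 to the left, hence
    the strict and weak inequalities. *)
Lemma trunc_local (s : R) : exists2 delta, 0 < delta &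
  forall t X, `|t| < delta -> trunc k v (s + t) X = trunc k v s X +
    t * ((k \in X) && (if 0 <= t then s < v X - v (X :\ k) else s <= v X - v (X :\ k)))%:R.
Proof.
pose gap X := v X - v (X :\ k) - s.
(* A set whose marginal is exactly [s] puts no bound on [t]; 1 is a default. *)
pose g X := if gap X == 0 then 1 else `|gap X|.
have g0 X : 0 < g X by rewrite /g; case: eqVneq => // h; rewrite normr_gt0.
exists (\big[Num.min/1]_X g X).
  by apply: (big_ind (fun x => 0 < x)) => // x y x0 y0; rewrite lt_min x0.
move=> t X td; have {td} : `|t| < g X by apply: lt_le_trans td _; exact: bigmin_le_cond.
rewrite /trunc /g /gap; have [kX|kX] := boolP (k \in X); last by rewrite mulr0n mulr0 addr0.
move: (v X) (v (X :\ k)) => x y; case: eqVneq => xy.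
  move=> _; have -> : x = y + s by lra.
  case: ifPn => t0.
    have -> : (s < y + s - y) = false by lra.
    by rewrite mulr0n mulr0 addr0 minxx; apply/min_idPl; lra.
  have -> : (s <= y + s - y) = true by lra.
  by rewrite mulr1n mulr1 minxx -addrA; apply/min_idPr; lra.
rewrite ltr_norml => /andP[].
have [xs|xs] : x - y - s < 0 \/ 0 < x - y - s.
  by case: ltgtP xy => // h _; [left|right].
- rewrite ltr0_norm// => h1 h2.
  have -> : (if 0 <= t then s < x - y else s <= x - y) = false by case: ifP => _; lra.
  rewrite mulr0n mulr0 addr0 (_ : Num.min x (y + s) = x); last by apply/min_idPl; lra.
  by apply/min_idPl; lra.
- rewrite gtr0_norm// => h1 h2.
  have -> : (if 0 <= t then s < x - y else s <= x - y) = true by case: ifP => _; lra.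
  rewrite mulr1n mulr1 (_ : Num.min x (y + s) = y + s); last by apply/min_idPr; lra.
  by rewrite -addrA; apply/min_idPr; lra.
Qed.

(** The one-sided variations of the divisor are the classes of [Up] and [Um], which may differ. By
    [marginal_slice] both give the same slope after multiplication by the power of the divisor, so
    the derivative exists even at the breaks. *)
Lemma is_derive_trunc (s : R) : s < v [set k]%SET ->
  is_derive s 1 (fun s => L (H k * D (trunc k v s) ^+ m.+1))
    (m.+1%:R * L (H k.+1 * D (slice k v s) ^+ m)).
Proof.
move=> sk; apply: is_derive_quadratic.
pose Up := [set X : {set 'I_n} | (k \in X) && (s < v X - v (X :\ k))]%SET.
pose Um := [set X : {set 'I_n} | (k \in X) && (s <= v X - v (X :\ k))]%SET.
pose al (U : {set {set 'I_n}}) := \sum_(X in U) rho X.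
have gk : s < v [set k]%SET - v ([set k]%SET :\ k) by rewrite finset.setDv (pm_set0 v_pm) subr0.
have slp U : U = Up \/ U = Um ->
    H k * al U * D (trunc k v s) ^+ m = H k.+1 * D (slice k v s) ^+ m.
  move=> hU; apply: marginal_slice => //.
  - exact: ltW.
  - by move=> X; case: hU => ->; rewrite inE => /andP[].
  - by case: hU => ->; rewrite !inE eqxx ?gk ?(ltW gk).
  - by move=> X; case: hU => ->; rewrite inE => /andP[_]// /ltW.
have [delta d0 hd] := trunc_local s.
have [Cp hCp] := pow_expansion (H k) (D (trunc k v s)) (al Up) m.
have [Cm hCm] := pow_expansion (H k) (D (trunc k v s)) (al Um) m.
have DE t U : `|t| < delta ->
    U = (if 0 <= t then Up else Um) -> D (trunc k v (s + t)) = D (trunc k v s) + kap t * al U.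
  move=> td UE; rewrite /div_of /al mulr_sumr [X in _ = _ + X]big_mkcond -big_split /=.
  apply: eq_bigr => X _; rewrite hd// rmorphD mulrDl; congr (_ + _).
  have -> : (X \in U) = (k \in X) &&
      (if 0 <= t then s < v X - v (X :\ k) else s <= v X - v (X :\ k)).
    by rewrite UE; case: ifP => _; rewrite inE.
  by case: (_ && _); rewrite ?mulr1 ?mulr0 ?rmorph0 ?mul0r.
exists (Num.min delta 1), (Num.max Cp Cm); split; first by rewrite lt_min d0 ltr01.
move=> t; rewrite lt_min => /andP[td /ltW t1].
have [t0|t0] := leP 0 t.
  have := hCp t t1; rewrite slp; last by left.
  rewrite -(@DE t Up) ?t0// => /le_trans; apply.
  by rewrite ler_wpM2r ?sqr_ge0// le_max lexx.
have := hCm t t1; rewrite slp; last by right.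
rewrite -(@DE t Um)//; last by rewrite leNgt t0.
move=> /le_trans; apply.
by rewrite ler_wpM2r ?sqr_ge0// le_max lexx orbT.
Qed.

End Derivative.
Hypothesis L_flag : L (\prod_(l < n) rho [set i : 'I_n | (l <= i)%N]%SET) = 1.

Lemma slice_continuous (k : 'I_n) v X : continuous (fun s : R => slice k v s X).
Proof.
move=> s; apply: (@continuous_min R R (fun=> v X) (fun s => v (k |: X) - s)).
  exact: cst_continuous.
by apply: cvgB; [exact: cvg_cst|exact: cvg_id].
Qed.

Lemma trunc_continuous (k : 'I_n) v X : continuous (fun s : R => trunc k v s X).
Proof.
move=> s; rewrite /trunc; case: (k \in X); last exact: cst_continuous.
apply: (@continuous_min R R (fun=> v X) (fun s => v (X :\ k) + s)).
  exact: cst_continuous.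
by apply: cvgD; [exact: cvg_cst|exact: cvg_id].
Qed.

(** The factor [H (n - m)] restricts to the last [m] coordinates, as [region m] does. The degree of
    the polymatroid truncated at height [s], divided by the factorial, is a primitive of the slice
    volumes. *)
Lemma volume_region m v : (m <= n)%N -> polymatroid v ->
  lebesgue_tuple (region m v) = (L (H (n - m) * D v ^+ m) / m`!%:R)%:E.
Proof.
elim: m v => [|m IH] v mn pv.
  rewrite /= diracE mem_set /=; last first.
    split=> // A An; rewrite (_ : A = finset.set0) ?finset.big_set0 ?(pm_set0 pv)//.
    apply/eqP; rewrite -finset.subset0; apply: fintype.subset_trans An _.
    by apply/fintype.subsetP => i; rewrite !inE subn0 leqNgt ltn_ord.
  by rewrite subn0 expr0 mulr1 fact0 divr1 hyper_lt_flag// L_flag.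
have kn : (n - m.+1 < n)%N by rewrite -subn_gt0 subKn.
pose k := Ordinal kn; have nk : (n - m.+1)%N = k by [].
have nk1 : (n - m)%N = k.+1 by rewrite -subnSK.
have km : #|[set i : 'I_n | (k < i)%N]%SET| = m by rewrite card_ord_gt subnSK// subKn// ltnW.
have v0 := pm_set0 pv.
have vk0 : 0 <= v [set k]%SET by rewrite -v0 (pm_mono pv)// finset.sub0set.
pose F s := L (H k * D (trunc k v s) ^+ m.+1) / m.+1`!%:R.
have -> : L (H (n - m.+1) * D v ^+ m.+1) / m.+1`!%:R = F (v [set k]%SET) - F 0.
  (* At height 0 the truncation ignores [k], so its divisor is a pullback from a smaller
     dimension. *)
  have -> : F 0 = 0.
    rewrite /F; have -> : trunc k v 0 = fun X => v (X :\ k).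
      apply/funext => X; rewrite /trunc addr0; case: ifPn => kX.
        by apply/min_idPr/(pm_mono pv)/finset.subD1set.
      congr v; apply/setP => i; rewrite !inE; case: eqP => // ->; by rewrite (negPf kX).
    have := hyper_lt_div0 kap rho_incomparable hyper_rho k pv; rewrite km => ->.
    by rewrite (lin0 L_lin) mul0r.
  (* At height [v [set k]] nothing is cut off, since no marginal of [k] exceeds the one at the empty
     set. *)
  rewrite subr0 /F; congr (L (_ * D _ ^+ _) / _).
  apply/funext => X; rewrite /trunc; case: ifPn => // kX.
  apply/esym/min_idPl; have := marginal_le pv (Y := finset.set0) _ kX (finset.sub0set _).
  by rewrite inE finset.setU0 v0 subr0 lerBlDl; exact.
have m1 : m.+1`!%:R != 0 :> R by rewrite pnatr_eq0 -lt0n fact_gt0.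
have m0 : m`!%:R != 0 :> R by rewrite pnatr_eq0 -lt0n fact_gt0.
apply: (@lebesgue_tuple_slices _ _ _ (v [set k]%SET)
  (fun s => L (H k.+1 * D (slice k v s) ^+ m) / m`!%:R)) => //.
- move=> x xk; have /andP[_ xk2] := xk; rewrite -nk1 -IH ?(ltnW mn)//; last first.
    exact: slice_polymatroid.
  congr lebesgue_tuple; apply/seteqP; split=> t /=.
    by move/(region_cons _ _ nk mn v0) => [].
  by move=> ?; apply/(region_cons _ _ nk mn v0).
- by move=> x t /(region_cons _ _ nk mn v0) [].
- move=> s; apply: cvgM; last exact: cvg_cst.
  by apply: continuous_pow_div => X; exact: slice_continuous.
- move=> s; apply: cvgM; last exact: cvg_cst.
  by apply: continuous_pow_div => X; exact: trunc_continuous.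
- move=> s /andP[s0 sk].
  have := is_derive_trunc pv sk; rewrite km => d1.
  have -> : F = (m.+1`!%:R)^-1 *: (fun s => L (H k * D (trunc k v s) ^+ m.+1)).
    by apply/funext => y; rewrite /F !fctE mulrC.
  apply: (is_derive_eq (is_deriveZ _ _)).
  rewrite factS natrM /GRing.scale /=; field.
  by rewrite m0 addrC natr1 pnatr_eq0.
Qed.

End LocalVolume.



(** * Volumes of the cells *)

Section MaxColored.
Variables (n : nat) (E : finType) (c : E -> 'I_n).

Lemma max_colored_section (T : {set E}) : max_colored c T ->
  exists2 t : 'I_n -> E, cancel t c & T = (t @: [set: 'I_n])%SET.
Proof.
case/andP => /coloredP cT /forallP hT.
have ex i : exists e, e \in T :&: block c i by have /set0Pn := hT i.
pose t i := xchoose (ex i).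
have tP i : (t i \in T) /\ c (t i) = i.
  by have := xchooseP (ex i); rewrite !inE => /andP[tT /eqP ct].
exists t => [i|]; first by case: (tP i).
apply/setP => e; apply/idP/imsetP => [eT|[i _ ->]]; last by case: (tP i).
by exists (c e); rewrite ?inE//; apply: cT; case: (tP (c e)).
Qed.

End MaxColored.

Section LocalChow.
Local Open Scope ring_scope.
Variables (R : realType) (n : nat) (E : finType) (c : E -> 'I_n).
Hypothesis n_gt0 : (0 < n)%N.
Hypothesis block_gt1 : forall i, (1 < #|block c i|)%N.
Variable L : chow R c -> R.

Local Notation G := (ncolored c).
Local Notation v := (val : G -> {set E}).
Local Notation x := (@chow_x R n E c).
Local Notation kap := (@chow_scalar R n E c).
Hypothesis L_lin : forall a u w, L (kap a * u + w) = a * L u + L w.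
Hypothesis L_chain : forall S : 'I_n -> G,
  (forall i j : 'I_n, (i < j)%N -> v (S i) \proper v (S j)) ->
  L (\prod_(i < n) x (S i)) = 1.
Variables (M : multimatroid R c) (t : 'I_n -> E).
Hypothesis tK : cancel t c.

Let T := (t @: [set: 'I_n])%SET.

Let t_inj : injective t.
Proof. exact: can_inj tK. Qed.

Let t_colored (A : {set 'I_n}) : colored c (t @: A)%SET.
Proof.
by apply/coloredP => _ _ /imsetP[i _ ->] /imsetP[j _ ->]; rewrite !tK => ->.
Qed.

Let tr (S : G) : {set 'I_n} := [set i | t i \in v S]%SET.
(** The pullback classes of [T] in coordinates, the index [i] standing for [t i]; [rho] of the empty
    set gathers the colored sets disjoint from [T]. *)
Let rho (A : {set 'I_n}) : chow R c := \sum_(S : G | tr S == A) x S.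

Let imset_tr S : (t @: tr S)%SET = v S :&: T.
Proof.
apply/setP => e; rewrite inE; apply/imsetP/andP => [[i]|[eS /imsetP[i _ ei]]].
  by rewrite inE => iS ->; rewrite iS imset_f.
by exists i => //; rewrite inE -ei.
Qed.

Let rho_pullback (A : {set 'I_n}) (Y : G) : v Y = (t @: A)%SET -> rho A = pullback R T Y.
Proof.
move=> YA; apply: eq_bigl => S; rewrite -imset_tr YA.
by apply/eqP/eqP => [->//|]; exact: imset_inj.
Qed.

Let rho_incomparable (A A' : {set 'I_n}) :
  ~~ (A \subset A') -> ~~ (A' \subset A) -> rho A * rho A' = 0.
Proof.
move=> AA' A'A; rewrite mulr_suml big1// => S /eqP SA; rewrite mulr_sumr big1// => S' /eqP SA'.
have trS (X Y : G) : v X \subset v Y -> tr X \subset tr Y.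
  by move=> /fintype.subsetP XY; apply/fintype.subsetP => i; rewrite !inE => /XY.
apply: chow_x_incomparable; apply/negP => /orP[/trS|/trS]; rewrite SA SA';
  exact/negP.
Qed.

Let hyper_rho i (A : {set 'I_n}) : i \in A -> hyper rho i * rho A = 0.
Proof.
move=> iA; have -> : hyper rho i = \sum_(S : G | t i \in v S) x S.
  rewrite /hyper /rho [RHS](partition_big tr (fun A => i \in A)) /=; last first.
    by move=> S tS; rewrite inE.
  apply: eq_bigr => A' iA'; apply: eq_bigl => S.
  by case: eqP => [SA|]; rewrite ?andbF// andbT; move: iA'; rewrite -SA inE.
rewrite mulr_sumr big1// => S /eqP SA; apply: chow_hyper_x => //.
by move: iA; rewrite -SA inE.
Qed.

(** The first set of the flag corresponds to [T] itself, so [top_prod_pullback] replaces the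
    pullbacks by the variables. The flag decreases, hence the reversal of the indices before
    [L_chain]. *)
Let L_flag : L (\prod_(l < n) rho [set i : 'I_n | (l <= i)%N]%SET) = 1.
Proof.
pose A (l : 'I_n) := [set i : 'I_n | (l <= i)%N]%SET.
have hA l : colored c (t @: A l)%SET && ((t @: A l)%SET != finset.set0).
  by rewrite t_colored; apply/set0Pn; exists (t l); rewrite imset_f// inE.
pose Y l : G := exist _ (t @: A l)%SET (hA l).
have YE l : v (Y l) = (t @: A l)%SET by [].
pose z : 'I_n := Ordinal n_gt0.
have YT : v (Y z) = T.
  by rewrite YE; congr (t @: _)%SET; apply/setP => i; rewrite !inE.
transitivity (L (\prod_(X <- [seq Y l | l <- enum 'I_n]) x X)).
  congr L; rewrite -(@top_prod_pullback R _ _ c (Y z)).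
  - rewrite big_map big_enum; apply: eq_bigr => l _.
    by rewrite YT; apply: rho_pullback; rewrite YE.
  - by rewrite YT card_imset// cardsT card_ord.
  - by apply: map_f; rewrite mem_enum.
  - by move=> _ /mapP[l _ ->]; rewrite YT YE; apply: imsetS; exact: finset.subsetT.
rewrite big_map big_enum /= (reindex_inj rev_ord_inj) /=.
apply: L_chain => i j ij; rewrite !YE.
have sA : A (rev_ord i) \proper A (rev_ord j).
  apply/properP; split.
    apply/fintype.subsetP => l; rewrite !inE; apply: leq_trans.
    by rewrite /= leq_sub2l// ltnS ltnW.
  exists (rev_ord j); rewrite !inE ?leqnn//= -ltnNge.
  by rewrite ltn_sub2l// (leq_ltn_trans ij).
rewrite properEcard (imsetS _ (proper_sub sA)) !card_imset//.
exact: proper_card.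
Qed.

Let vt (A : {set 'I_n}) := M (t @: A)%SET.

Let vt_pm : polymatroid vt.
Proof.
split=> [|A A' AA'|A A']; rewrite /vt.
- by rewrite imset0 rk_set0.
- by apply: rk_mono; rewrite ?t_colored// imsetS.
- rewrite imsetU imsetI; last by move=> i j _ _; exact: t_inj.
  by apply: rk_submod; rewrite ?t_colored// -imsetU t_colored.
Qed.

Let div_pullback : div_of kap rho vt = \sum_(S : G) kap (M (v S)) * pullback R T S.
Proof.
rewrite (@sum_pullback_weighted R n E c T (fun A => kap (M A))); last first.
  by rewrite rk_set0 rmorph0.
rewrite [RHS](partition_big tr xpredT)//=; apply: eq_bigr => A _.
rewrite mulr_sumr; apply: eq_bigr => S /eqP SA.
by rewrite /vt -SA imset_tr.
Qed.

Lemma volume_region_chow : lebesgue_tuple (region n vt) =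
  (L ((\sum_(S : G) kap (M (v S)) * pullback R T S) ^+ n) / n`!%:R)%:E.
Proof.
rewrite (volume_region L_lin rho_incomparable hyper_rho L_flag (leqnn n) vt_pm).
by rewrite div_pullback subnn /hyper_lt big_pred0 ?mul1r.
Qed.

End LocalChow.

(** * Cells in coordinates *)

Section Unfold.
Local Open Scope ring_scope.
Variables (R : realType) (n : nat) (E : finType) (c : E -> 'I_n).
Hypothesis block_gt1 : forall i, (1 < #|block c i|)%N.

Lemma lincombE (T : {set E}) (x : E -> R) : lincomb c T x =
  \pi_(Quotient.quot (block_constant R c))%qT [ffun e => if e \in T then x e else 0].
Proof.
rewrite /lincomb /ebar -raddf_sum; congr (\pi_(_)%qT _).
apply/ffunP => e; rewrite sum_ffunE ffunE.
under eq_bigr do rewrite ffunE mulrb.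
rewrite -big_mkcondr /=; case: ifPn => eT.
  rewrite (big_pred1 e)// => e' /=; rewrite [RHS]eq_sym.
  by case: eqP => [<-|]; rewrite ?eT ?andbF.
by rewrite big_pred0// => e'; case: eqP => [<-|]; rewrite ?(negPf eT) ?andbF.
Qed.

(** An element of [T] has a partner in its block, and the partner is outside [T] by coloredness. The
    difference of the two vectors is 0 at the partner and constant on the block. *)
Lemma lincomb_inj (T : {set E}) (x y : E -> R) : colored c T ->
  lincomb c T x = lincomb c T y -> {in T, x =1 y}.
Proof.
move=> /coloredP cT; rewrite !lincombE => /eqP; rewrite -Quotient.idealrBE => /forallP h e eT.
have [e' /andP[/eqP ce ee']] := block_other (block_gt1 (c e)).
have /forallP/(_ e')/implyP/(_ (introT eqP (esym ce)))/eqP := h e.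
rewrite !ffunE eT.
have -> : (e' \in T) = false by apply: contraNF ee' => e'T; rewrite (cT e' e).
by rewrite subrr => /eqP; rewrite subr_eq0 => /eqP.
Qed.

Variable t : 'I_n -> E.
Hypothesis tK : cancel t c.
Let T := (t @: [set: 'I_n])%SET.

Let T_colored : colored c T.
Proof.
by apply/coloredP => _ _ /imsetP[i _ ->] /imsetP[j _ ->]; rewrite !tK => ->.
Qed.

Let sum_t (A : {set 'I_n}) (y : E -> R) :
  \sum_(e in (t @: A)%SET) y e = \sum_(i in A) y (t i).
Proof. by rewrite big_imset//= => i j _ _; exact: can_inj tK _ _. Qed.

Let nth_t (s : n.-tuple (measurableTypeR R)) (i : 'I_n) : tnth s (c (t i)) = nth 0 s i.
Proof. by rewrite tK (tnth_nth 0). Qed.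

Lemma coord_polytope (M : multimatroid R c) :
  (Defs.coord c T @^-1` indep_polytope M T = region n (fun A => M (t @: A)%SET))%classic.
Proof.
apply/seteqP; split=> s /=.
  move=> [y [y0 yM] /(lincomb_inj T_colored) ys].
  have {}ys (i : 'I_n) : y (t i) = nth 0 s i by rewrite ys ?imset_f// nth_t.
  split=> [i hi|A _]; first by rewrite -(ys (Ordinal hi)) y0// imset_f.
  rewrite subnn; under eq_bigr do rewrite subn0 -ys.
  by rewrite -sum_t yM// imsetS// finset.subsetT.
move=> [s0 sM]; exists (fun e => tnth s (c e)) => //; split.
  by move=> _ /imsetP[i _ ->]; rewrite nth_t s0.
move=> X XT; have -> : X = (t @: [set i | t i \in X])%SET.
  apply/setP => e; apply/idP/imsetP => [eX|[i + ->]]; last by rewrite inE.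
  by have /imsetP[i _ ei] := fintype.subsetP XT e eX; exists i => //; rewrite inE -ei.
rewrite sum_t; apply: le_trans (sM _ _).
  by rewrite subnn; apply: ler_sum => i _; rewrite nth_t subn0.
by apply/fintype.subsetP => i _; rewrite inE subnn.
Qed.

Lemma coord_simplex :
  (Defs.coord c T @^-1` std_simplex R c T =
   [set s : n.-tuple (measurableTypeR R) | (forall i, (i < n)%N -> 0 <= nth 0 s i) /\
    \sum_(i < n) nth 0 s i <= 1])%classic.
Proof.
have sumT (y : E -> R) : \sum_(e in T) y e = \sum_(i < n) y (t i).
  by rewrite sum_t; apply: eq_bigl => i; rewrite inE.
apply/seteqP; split=> s /=.
  move=> [y [y0 yM] /(lincomb_inj T_colored) ys].
  have {}ys (i : 'I_n) : y (t i) = nth 0 s i by rewrite ys ?imset_f// nth_t.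
  split=> [i hi|]; first by rewrite -(ys (Ordinal hi)) y0// imset_f.
  by under eq_bigr do rewrite -ys; rewrite -sumT.
move=> [s0 s1]; exists (fun e => tnth s (c e)) => //; split.
  by move=> _ /imsetP[i _ ->]; rewrite nth_t s0.
by rewrite sumT; under eq_bigr do rewrite nth_t.
Qed.

Lemma Vol_at_coord (A : set (NR R c)) :
  Vol_at T A = (n`!%:R%:E * lebesgue_tuple (Defs.coord c T @^-1` A)%classic)%E.
Proof.
rewrite /Vol_at coord_simplex lebesgue_tuple_simplex ?ler01//=.
by rewrite expr1n mul1r invrK.
Qed.

End Unfold.

Theorem theorem5p1 (R : realType) (n : nat) (E : finType) (c : E -> 'I_n)
    (hn : 0 < n) (hc : forall i : 'I_n, 1 < #|block c i|)
    (M : multimatroid R c) :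
  ((chow_degree (divisor M ^+ n)%R)%:E = Vol_IPC M)%E.
Proof.
have [L [L_lin L_chain]] := degree_map_exists R hc.
(* The map [L] witnesses that the definite description is satisfied. It is also kept for itself: it
   is linear on the whole ring, whereas the described map is controlled only in degree [n]. *)
have f_degree : is_degree_map (@chow_degree R n E c).
  apply: (@xgetPex _ (fun=> 0%R) [set f | is_degree_map f]%classic).
  by exists L; split=> // a u w _ _; exact: L_lin.
rewrite (degree_map_div_split hc hn f_degree L_lin L_chain M) -sumEFin.
apply: eq_bigr => T /max_colored_section[t tK ->].
rewrite (Vol_at_coord hc tK) (coord_polytope hc tK).
(* The factor [n!] from the normalization by the simplex cancels the [n!] dividing the degree. *)
by rewrite (volume_region_chow hn hc L_lin L_chain M tK) -EFinM mulrC divfK.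
Qed.
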